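(* Let $\mathbf{H}$ be the set of rooted non-separable triangulations in which every vertex not incident to the root has degree at least $4$, and let $\mathbf{H}^*$ be the set of rooted non-separable triangulations in which every vertex has degree at least $4$. Let $H(t)$ and $H^*(t)$ be the generating functions of $\mathbf{H}$ and $\mathbf{H}^*$ respectively, where a map with $3n$ edges contributes $t^n$. Then $$H^*(t)=\frac{1-5t+5t^2-3t^3}{1-t}\,H(t).$$
   Context: A (planar) map is a proper embedding of a connected graph (loops and multiple edges a priori allowed) into the two-dimensional sphere, considered up to continuous (orientation-preserving) deformations. A map is rooted if one of its edges is distinguished as the root and given an orientation. A map is a triangulation if all its faces have degree $3$. A map is non-separable if it is loopless and 2-connected (the deletion of any vertex does not disconnect the map); multiple edges are allowed. A vertex is incident to the root if it is one of the two endpoints of the root edge. The number of edges of a triangulation is always a multiple of $3$; a triangulation with $3n$ edges has $2n$ faces and $n+2$ vertices. The series $H(t)$ is the unique power series in $t$ satisfying $16t^{2}(t-1)^{4}H^{3}+8t(t-1)^{2}(t^{4}+4t^{3}-13t^{2}+8t+1)H^{2}+(t^{8}+12t^{7}-14t^{6}-84t^{5}+207t^{4}-192t^{3}+86t^{2}-16t+1)H+t^{4}(t-1)(t^{3}+5t^{2}-8t+1)=0$. *)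

(* Defs.v *)
From mathcomp Require Import all_boot all_order all_fingroup all_algebra.

Set Implicit Arguments.
Unset Strict Implicit.
Unset Printing Implicit Defensive.

(* A map on an oriented surface is encoded by its rotation system.  A dart    *)
(* is an edge together with an orientation; [edge_of] reverses a dart, and    *)
(* [node_of] sends a dart to the next one, counterclockwise, around its       *)
(* origin.  Vertices, edges and faces are the cycles of [node_of], [edge_of]  *)
(* and [face_of].  A root edge with an orientation is exactly a dart.         *)
Definition rmap (D : finType) : Type := ({perm D} * {perm D} * D)%type.

Section RootedMap.

Variable D : finType.
Implicit Types (M N : rmap D) (x y : D) (v w : {set D}).

Definition node_of M : {perm D} := M.1.1.
Definition edge_of M : {perm D} := M.1.2.
Definition root_of M : D := M.2.

(* Follow x to its head, then take the next dart around that vertex, so that  *)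
(* the face traced out lies to the right of x.                                *)
Definition face_of M : {perm D} := (edge_of M * node_of M)%g.

Definition vertices M : {set {set D}} := porbits (node_of M).
Definition edges M : {set {set D}} := porbits (edge_of M).
Definition faces M : {set {set D}} := porbits (face_of M).

(* The vertex from which the dart x leaves. *)
Definition origin M x : {set D} := porbit (node_of M) x.

Definition adjacent M v w : bool := [exists x in v, edge_of M x \in w].

(* The subgraph induced by the set V of vertices is connected. *)
Definition connected_on M (V : {set {set D}}) : bool :=
  [forall v in V, forall w in V,
     connect [rel u u' | [&& u \in V, u' \in V & adjacent M u u']] v w].

(* Sphericity is Euler's relation V + F = E + 2. *)
Definition planar_map M : bool :=
  [&& [forall x, (edge_of M x != x) && (edge_of M (edge_of M x) == x)],
      connected_on M (vertices M)
    & #|vertices M| + #|faces M| == #|edges M| + 2].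

(* The degree of a face or vertex is its number of darts; a loop therefore    *)
(* counts twice in the degree of its vertex.                                  *)
Definition triangulation M : bool :=
  planar_map M && [forall f in faces M, #|f| == 3].

Definition loopless M : bool :=
  [forall x, edge_of M x \notin origin M x].

Definition two_connected M : bool :=
  [forall v in vertices M, connected_on M (vertices M :\ v)].

Definition nonseparable M : bool := loopless M && two_connected M.

Definition incident_to_root M v : bool :=
  (v == origin M (root_of M)) || (v == origin M (edge_of M (root_of M))).

Definition bold_H M : bool :=
  [&& triangulation M, nonseparable M &
      [forall v in vertices M, ~~ incident_to_root M v ==> (4 <= #|v|)]].

Definition bold_Hstar M : bool :=
  [&& triangulation M, nonseparable M & [forall v in vertices M, 4 <= #|v|]].

(* Equality up to orientation-preserving deformation: a relabelling of the    *)
(* darts that respects rotations, edges and the root.                         *)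
Definition isomorphic M N : bool :=
  [exists p : {perm D}, [&& node_of N == (node_of M ^ p)%g,
                            edge_of N == (edge_of M ^ p)%g
                          & root_of N == p (root_of M)]].

(* [equivalence_partition] counts classes only for an equivalence relation.   *)
Lemma isomorphic_equivalence : equivalence_rel isomorphic.
Proof.
have refl M : isomorphic M M.
  by apply/existsP; exists 1%g; rewrite !conjg1 perm1 !eqxx.
have sym M N : isomorphic M N -> isomorphic N M.
  case/existsP=> p /and3P[/eqP n /eqP e /eqP r]; apply/existsP; exists p^-1%g.
  by rewrite n e r !conjgK permK !eqxx.
have trans M N P : isomorphic M N -> isomorphic N P -> isomorphic M P.
  case/existsP=> p /and3P[/eqP n /eqP e /eqP r].
  case/existsP=> q /and3P[/eqP n' /eqP e' /eqP r'].
  apply/existsP; exists (p * q)%g.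
  by rewrite n' e' r' n e r !conjgM permM !eqxx.
move=> M N P; split=> [|MN]; first exact: refl.
by apply/idP/idP; [apply/trans/sym | apply: trans].
Qed.

End RootedMap.

(* A class of rooted maps, given on every finite type of darts. *)
Definition map_class : Type := forall D : finType, pred (rmap D).

(* A map with m edges has 2m darts, which may be labelled by 'I_(2 * m).      *)
Definition count_maps (K : map_class) (m : nat) : nat :=
  #|equivalence_partition (@isomorphic 'I_(2 * m))
      [set M : rmap 'I_(2 * m) | K 'I_(2 * m) M]|.

Import GRing.Theory.
Local Open Scope ring_scope.

(* The formal power series f(t) is its sequence of coefficients. *)
Definition fps (R : Type) : Type := nat -> R.

Definition fps_of_poly (R : nzRingType) (p : {poly R}) : fps R := fun n => p`_n.

Definition fps_mul (R : nzRingType) (f g : fps R) : fps R :=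
  fun n => \sum_(i < n.+1) f i * g (n - i)%N.

(* The first n.+1 coefficients of 1 / f. *)
Fixpoint fps_inv_seq (R : unitRingType) (f : fps R) (n : nat) : seq R :=
  if n is m.+1 then
    let s := fps_inv_seq f m in
    rcons s (- (f 0%N)^-1 * \sum_(i < m.+1) f i.+1 * s`_(m - i))
  else [:: (f 0%N)^-1].

Definition fps_inv (R : unitRingType) (f : fps R) : fps R :=
  fun n => (fps_inv_seq f n)`_n.

Definition fps_div (R : unitRingType) (f g : fps R) : fps R :=
  fps_mul f (fps_inv g).

Lemma size_fps_inv_seq (R : unitRingType) (f : fps R) n :
  size (fps_inv_seq f n) = n.+1.
Proof. by elim: n => //= n IHn; rewrite size_rcons IHn. Qed.

Lemma nth_fps_inv_seq (R : unitRingType) (f : fps R) n i :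
  (i <= n)%N -> (fps_inv_seq f n)`_i = fps_inv f i.
Proof.
elim: n => [|n IHn]; first by case: i.
rewrite leq_eqVlt => /predU1P[-> // | ltin].
by rewrite /= nth_rcons size_fps_inv_seq ltin IHn.
Qed.

Lemma fps_mul_inv (R : unitRingType) (f : fps R) :
  f 0%N \is a GRing.unit -> fps_mul f (fps_inv f) =1 fps_of_poly 1.
Proof.
move=> Uf [|n]; rewrite /fps_mul /fps_of_poly coef1 big_ord_recl.
  by rewrite big_ord0 addr0 divrr.
rewrite {1}/fps_inv /= nth_rcons size_fps_inv_seq ltnn eqxx mulrA mulrN divrr //.
rewrite mulN1r addrC; apply/eqP; rewrite subr_eq0; apply/eqP/eq_bigr => i _.
by rewrite nth_fps_inv_seq ?leq_subr.
Qed.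

(* A map with 3n edges contributes t^n. *)
Definition gen_fun (K : map_class) : fps rat :=
  fun n => (count_maps K (3 * n))%:R.

(* Main.v *)
(* In a loopless triangulation the faces around a vertex v join its           *)
(* successive neighbours, so deleting v cannot disconnect the map:            *)
(* non-separability is just looplessness.  The identity then follows from two *)
(* local surgeries.  A vertex u of degree 2 lies in a digon, and deleting it  *)
(* and closing the digon removes 3 edges; deleting a vertex u of degree 3     *)
(* also removes 3 edges.  Let F be defined as H, but allowing the apex a of   *)
(* the root face (its vertex off the root edge) to have degree 3.             *)
(* Deleting that apex shows F = H + t F.  For the root edge uv, with u of     *)
(* degree 2 in a map of H, closing the digon gives t H, and v then has degree *)
(* at least 4.  With u of degree 3, deleting u gives the maps of F whose root *)
(* head has degree at least 3, that is t (F - t H); if v has degree 3 too, it *)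
(* has degree 2 after the deletion, which gives t^2 H.  Hence                 *)
(*   H* = H - 2 t H - 2 t (H / (1 - t) - t H) + t^2 H.                        *)
Require Import Defs.
From mathcomp Require Import all_boot all_order all_fingroup all_algebra.
From mathcomp Require Import zify lra.

Set Implicit Arguments.
Unset Strict Implicit.
Unset Printing Implicit Defensive.

(** * Rotation systems of loopless triangulations *)

(** A map of [bold_H] fails to lie in [bold_Hstar] only because an end of its root edge has degree 2
    or 3. If one end has degree 2, the other has degree at least 4 ([degree_next_to_degree2]), so
    inclusion-exclusion has a single overlap: both ends of degree 3 ([count_H_split]).

    Each correction term counts maps with a vertex of small degree at the root, and is evaluated by
    deleting that vertex. Deletion is studied through its inverse: [insert_digon] and [insert_star]
    are two instances of [graft], which adds six darts and reglues faces. By [graft_good] the result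
    is a loopless triangulation exactly when the original map is; [insert_digon_onto] and
    [insert_star_onto] show that every relevant vertex arises in this way. An insertion is moreover
    natural, injective and rigid on its new darts, hence a bijection on isomorphism classes
    ([iso_classes_insertion]).

    Deleting a vertex of degree 3 leads from [bold_H] into the larger class [bold_F]. Deleting an
    apex of degree 3 there gives F = H + t F ([count_F]), the source of the denominator 1 - t.
    Eliminating F yields the recurrence [count_Hstar_S]. *)

Section Orbits.

Variable T : finType.
Implicit Types (s : {perm T}) (x y : T).

Lemma porbit_image s x : porbit s (s x) = porbit s x.
Proof. by have := porbit_perm s 1 x; rewrite expg1. Qed.

Lemma mem_porbit_image s x : s x \in porbit s x.
Proof. by rewrite -porbit_image porbit_id. Qed.

Lemma porbit_step s x y : s x = y -> y \in porbit s x.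
Proof. by move <-; apply: mem_porbit_image. Qed.

Lemma porbit_trans s y x z :
  x \in porbit s y -> y \in porbit s z -> x \in porbit s z.
Proof. by rewrite -!eq_porbit_mem => /eqP-> /eqP->. Qed.

Lemma porbit_ind s x (P : T -> Prop) :
  P x -> (forall y, P y -> P (s y)) -> forall y, y \in porbit s x -> P y.
Proof.
move=> Px Ps y /porbitP[i ->]; elim: i => [|i IHi]; first by rewrite perm1.
by rewrite expgSr permM; apply: Ps.
Qed.

Lemma partition_porbits s : partition (porbits s) [set: T].
Proof.
apply/and3P; split.
- rewrite eqEsubset subsetT; apply/subsetP => x _; apply/bigcupP.
  by exists (porbit s x); rewrite ?imset_f ?porbit_id.
- apply/trivIsetP => _ _ /imsetP[x _ ->] /imsetP[y _ ->]; apply: contraNT.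
  case/pred0Pn => z /andP[/=]; rewrite -!eq_porbit_mem => /eqP zx /eqP zy.
  by rewrite -zx -zy.
- by apply/imsetP => -[x _ x0]; have := porbit_id s x; rewrite -x0 inE.
Qed.

Lemma card_porbits_uniform s k :
  (forall x, #|porbit s x| = k) -> #|T| = #|porbits s| * k.
Proof.
move=> sk; rewrite -cardsT; apply: card_uniform_partition (partition_porbits s).
by move=> _ /imsetP[x _ ->].
Qed.

Lemma porbit2 s x : s (s x) = x -> porbit s x = [set x; s x].
Proof.
move=> ssx; apply/setP => y; rewrite !inE; apply/idP/orP.
  elim/porbit_ind: y / => [|y]; first by left.
  by case=> /eqP->; [right|left; rewrite ssx].
by case=> /eqP->; rewrite ?mem_porbit_image ?porbit_id.
Qed.

Lemma porbit3 s x : s (s (s x)) = x -> porbit s x = [set x; s x; s (s x)].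
Proof.
move=> sssx; apply/setP => y; rewrite !inE; apply/idP/idP.
  elim/porbit_ind: y / => [|y]; first by rewrite eqxx.
  by case/orP => [/orP[]|] /eqP->; rewrite ?sssx eqxx ?orbT.
case/orP => [/orP[]|] /eqP->; first exact: porbit_id.
  exact: mem_porbit_image.
by rewrite -porbit_image mem_porbit_image.
Qed.

End Orbits.

Section MapFacts.

Variables (D : finType) (M : rmap D).
Implicit Types x y : D.
Local Notation n := (node_of M).
Local Notation e := (edge_of M).
Local Notation f := (face_of M).
Local Notation r := (root_of M).

Definition degree x : nat := #|porbit n x|.

(* Connectedness as an induction principle: it follows a single direction of  *)
(* the permutations since D is finite.                                        *)
Definition dart_connected : Prop :=
  forall P : pred D, P r -> (forall x, P x -> P (n x)) ->
    (forall x, P x -> P (e x)) -> forall x, P x.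

(** Working form of a loopless spherical triangulation. With V the number of vertices, 2E = 3F =
    [#|D|] turns Euler's relation V + F = E + 2 into 6V = [#|D|] + 12, which mentions neither edges
    nor faces. *)
Record good : Prop := Good {
  good_edge : forall x, e (e x) = x;
  good_face : forall x, f (f (f x)) = x;
  good_loop : forall x, e x \notin porbit n x;
  good_conn : dart_connected;
  good_euler : 6 * #|porbits n| = #|D| + 12
}.

Lemma faceE x : f x = n (e x).
Proof. by rewrite permM. Qed.

Lemma face_edge_porbit x : porbit n (f x) = porbit n (e x).
Proof. by rewrite faceE porbit_image. Qed.

Hypothesis gM : good.

Lemma nodeE x : n x = f (e x).
Proof. by rewrite faceE good_edge. Qed.

Lemma edge_neq x : e x != x.
Proof. by apply: contraNneq (good_loop gM x) => {1}->; apply: porbit_id. Qed.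

Lemma loop_neq x : porbit n (e x) != porbit n x.
Proof. by rewrite eq_porbit_mem good_loop. Qed.

Lemma face1_neq x : porbit n (f x) != porbit n x.
Proof. by rewrite face_edge_porbit loop_neq. Qed.

Lemma face2_neq x : porbit n (f (f x)) != porbit n x.
Proof.
by rewrite -{2}(good_face gM x) face_edge_porbit (face_edge_porbit (f (f x)))
           -face_edge_porbit eq_sym loop_neq.
Qed.

Lemma face_neq x : f x != x.
Proof. by apply: contraNneq (face1_neq x) => ->. Qed.

(** At a vertex of degree 1 the face through its only dart would have a loop as third side. *)
Lemma degree_ge2 x : 2 <= degree x.
Proof.
rewrite /degree ltnNge; apply/negP => /card_le1_eqP sub1.
have nx : n x = x by apply: sub1; rewrite ?mem_porbit_image ?porbit_id.
have := face2_neq (e x); rewrite -nodeE nx face_edge_porbit.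
by rewrite eqxx.
Qed.

Lemma degree_porbit x y : y \in porbit n x -> degree y = degree x.
Proof. by rewrite -eq_porbit_mem /degree => /eqP->. Qed.

End MapFacts.

Definition good_map (D : finType) (M : rmap D) : bool :=
  triangulation M && nonseparable M.

Section GoodP.

Variables (D : finType) (M : rmap D).
Implicit Types x y : D.
Local Notation n := (node_of M).
Local Notation e := (edge_of M).
Local Notation f := (face_of M).
Local Notation r := (root_of M).

Lemma mem_vertices x : porbit n x \in vertices M.
Proof. exact: imset_f. Qed.

Lemma adjacent_dart x : adjacent M (porbit n x) (porbit n (e x)).
Proof. by apply/existsP; exists x; rewrite !porbit_id. Qed.

Section Involutive.

Hypothesis eK : involutive e.

Lemma adjacent_sym : symmetric (adjacent M).
Proof.
by move=> v w; apply/existsP/existsP => -[x /andP[xv xw]];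
  exists (e x); rewrite eK xv xw.
Qed.

(** If [P] held at [x0] but failed at the root, its complement would be closed too, since orbits of
    a permutation can be traversed backwards; connectedness from the root would then make [P] fail
    at [x0]. *)
Lemma dart_connected_from x0 : dart_connected M ->
  forall P : pred D, P x0 -> (forall x, P x -> P (n x)) ->
    (forall x, P x -> P (e x)) -> forall x, P x.
Proof.
move=> cM P Px0 Pn Pe.
suffices Pr : P r by apply: cM.
apply/negPn/negP => nPr.
suffices /(_ x0) : forall x, ~~ P x by rewrite Px0.
apply: (cM (fun x => ~~ P x)) => // x; apply: contra => Px.
  have xnx: x \in porbit n (n x) by rewrite porbit_sym mem_porbit_image.
  exact: (porbit_ind (P := P) Px Pn xnx).
by rewrite -[x]eK Pe.
Qed.

Lemma connected_onP : reflect (dart_connected M) (connected_on M (vertices M)).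
Proof.
apply: (iffP idP) => [/forall_inP cM P Pr Pn Pe x | cM].
  have Pv y z : z \in porbit n y -> P y -> P z.
    by move=> yz Py; apply: (porbit_ind (P := P) Py Pn yz).
  have /connectP[p] := forall_inP (cM _ (mem_vertices r)) _ (mem_vertices x).
  elim: p (r) Pr => [|v p IHp] y Py /=.
    move=> _ xy; apply: Pv Py; rewrite -xy; exact: porbit_id.
  case/andP=> /and3P[_ /imsetP[z _ ->{v}] /existsP[w /andP[yw zw]]] pz.
  move/IHp; apply => //; apply: Pv (Pe _ (Pv _ _ yw Py)).
  by rewrite porbit_sym.
pose R : rel {set D} :=
  [rel u u' | [&& u \in vertices M, u' \in vertices M & adjacent M u u']].
have Rsym : symmetric R by move=> u u'; rewrite /R /= adjacent_sym andbCA.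
have conn_r x : connect R (porbit n r) (porbit n x).
  apply: (cM [pred x | connect R (porbit n r) (porbit n x)]) => [|y|y] /=.
  - exact: connect0.
  - by rewrite porbit_image.
  - move/connect_trans; apply; apply: connect1.
    by rewrite /R /= !mem_vertices adjacent_dart.
apply/forall_inP => _ /imsetP[x _ ->]; apply/forall_inP => _ /imsetP[y _ ->].
apply: connect_trans (conn_r y).
by rewrite (sym_connect_sym Rsym).
Qed.

End Involutive.

(* The neighbours of a vertex v are linked by the faces around v, by sides    *)
(* opposite to v; hence every path through v has a detour.                    *)
Lemma good_two_connected : good M -> two_connected M.
Proof.
move=> gM; apply/forall_inP => _ /imsetP[x0 _ ->].
set v := porbit n x0; set V := _ :\ _.
set R : rel {set D} := [rel u u' | [&& u \in V, u' \in V & adjacent M u u']].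
have Rsym : symmetric R.
  by move=> u u'; rewrite /R /= (adjacent_sym (good_edge gM)) andbCA.
have inV x : (porbit n x \in V) = (x \notin v).
  by rewrite !inE mem_vertices andbT eq_porbit_mem.
have nv x : (n x \in v) = (x \in v) by rewrite -!eq_porbit_mem porbit_image.
have headV x : x \in v -> porbit n (e x) \in V.
  rewrite inV -eq_porbit_mem => /eqP xv.
  by rewrite -eq_porbit_mem -xv (loop_neq gM).
have heads x : x \in v -> connect R (porbit n (e x0)) (porbit n (e x)).
  move=> xv; pose P y := (y \in v) &&
    connect R (porbit n (e x0)) (porbit n (e y)).
  suffices: P x by case/andP.
  elim/porbit_ind: x / xv => [|x /andP[xv cx]].
    by rewrite /P /v porbit_id connect0.
  have nxv : n x \in v by rewrite nv.
  rewrite /P nxv; apply: connect_trans cx (connect1 _).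
  rewrite /R /= !headV //= (adjacent_sym (good_edge gM)).
  have <- : porbit n (e (f (f (e x)))) = porbit n (e x).
    by rewrite -face_edge_porbit (good_face gM).
  by rewrite nodeE // -(face_edge_porbit M (f (e x))) adjacent_dart.
(* Dart induction walks through the deleted vertex as well, so the invariant is a disjunction. On
   leaving [v], the detour [heads] restores connectedness. *)
have conn_head x : x \notin v -> connect R (porbit n (e x0)) (porbit n x).
  have: (x \in v) || connect R (porbit n (e x0)) (porbit n x).
    apply: (dart_connected_from (x0 := x0) (good_edge gM) (good_conn gM)
      (P := [pred x | (x \in v) || connect R (porbit n (e x0)) (porbit n x)]))
      x => [|x|x] /=.
    - by rewrite /v porbit_id.
    - by rewrite porbit_image nv.
    have [exv //|exv] := boolP (e x \in v).
    have [xv _|xv /=] := boolP (x \in v); first exact: heads.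
    move/connect_trans; apply; apply: connect1.
    by rewrite /R /= !inV xv exv adjacent_dart.
  by case/orP => // ->.
apply/forall_inP => w; rewrite 2!inE => /andP[/[swap] /imsetP[x _ ->] xv].
apply/forall_inP => w'; rewrite 2!inE => /andP[/[swap] /imsetP[y _ ->] yv].
rewrite eq_porbit_mem in xv; rewrite eq_porbit_mem in yv.
by apply: connect_trans (conn_head y yv);
  rewrite (sym_connect_sym Rsym) conn_head.
Qed.

Lemma goodP : reflect (good M) (good_map M).
Proof.
apply: (iffP idP) => [/andP[/andP[pM /forall_inP fM] /andP[/forallP lM _]]|gM].
  case/and3P: pM => /forallP eM cM /eqP euler.
  have eK x : e (e x) = x by case/andP: (eM x) => _ /eqP.
  have f3 x : #|porbit f x| = 3 by apply/eqP/fM; apply: imset_f.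
  split => //; first by move=> x; have := iter_porbit f x; rewrite f3.
    exact/(connected_onP eK).
  have e2 x : #|porbit e x| = 2.
    by rewrite porbit2 // cards2 eq_sym; case/andP: (eM x) => ->.
  have := card_porbits_uniform e2; have := card_porbits_uniform f3.
  move: euler; rewrite /vertices /faces /edges.
  by move: #|porbits n| #|porbits f| #|porbits e| #|D| => v b a d; lia.
have f3 x : #|porbit f x| = 3.
  rewrite porbit3 ?(good_face gM) // -setUA cardsU1 cards2 !inE.
  have := face_neq gM x; have := face_neq gM (f (f x)); rewrite (good_face gM).
  have := face_neq gM (f x).
  by rewrite eq_sym [f x == x]eq_sym => -> /negPf-> /negPf->.
have e2 x : #|porbit e x| = 2.
  by rewrite porbit2 ?(good_edge gM) // cards2 eq_sym edge_neq.
apply/and3P; split; last exact: good_two_connected.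
  apply/andP; split; last by apply/forall_inP => _ /imsetP[x _ ->]; rewrite f3.
  apply/and3P; split; last 1 first.
  - have := card_porbits_uniform e2; have := card_porbits_uniform f3.
    have := good_euler gM; rewrite /vertices /faces /edges.
    by move: #|porbits n| #|porbits f| #|porbits e| #|D| => v b a d; lia.
  - by apply/forallP => x; rewrite edge_neq // (good_edge gM) eqxx.
  - exact/(connected_onP (good_edge gM))/good_conn.
by apply/forallP => x; apply: good_loop.
Qed.

End GoodP.

(** * Counting isomorphism classes *)

Section CountingClasses.

(** [phi] is asked to be injective and onto only up to equivalence. The induced map on classes is
    [h], which saturates the image of a class. *)
Lemma card_equivalence_partition (T1 T2 : finType) (e1 : rel T1) (e2 : rel T2)
    (S1 : {set T1}) (S2 : {set T2}) (phi : T1 -> T2) :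
    equivalence_rel e1 -> equivalence_rel e2 ->
    (forall x, x \in S1 -> phi x \in S2) ->
    {in S1 &, forall x y, e2 (phi x) (phi y) = e1 x y} ->
    (forall y, y \in S2 -> exists2 x, x \in S1 & e2 (phi x) y) ->
  #|equivalence_partition e1 S1| = #|equivalence_partition e2 S2|.
Proof.
move=> E1 E2 phiS phiE phi_onto.
pose P1 x := [set y in S1 | e1 x y]; pose P2 x := [set y in S2 | e2 x y].
pose h (A : {set T1}) := [set y in S2 | [exists x in A, e2 (phi x) y]].
have hP1 x : x \in S1 -> h (P1 x) = P2 (phi x).
  move=> Sx; apply/setP => y; rewrite !inE; case Sy: (y \in S2) => //=.
  apply/exists_inP/idP => [[x'] | exy].
    by rewrite inE => /andP[Sx']; rewrite -phiE // => /((E2 _ _ y).2)->.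
  by exists x => //; rewrite inE Sx (E1 x x x).1.
have -> : equivalence_partition e2 S2 = h @: equivalence_partition e1 S1.
  apply/setP => A; apply/imsetP/imsetP => [[y Sy ->]|[B /imsetP[x Sx ->] ->]].
    have [x Sx exy] := phi_onto y Sy; exists (P1 x); first exact: imset_f.
    by rewrite hP1 //; apply/setP => z; rewrite !inE ((E2 _ _ z).2 exy).
  by exists (phi x); rewrite ?phiS // -[RHS](hP1 x Sx).
rewrite card_in_imset // => A B /imsetP[x Sx ->] /imsetP[y Sy ->].
rewrite -/(P1 x) -/(P1 y) !hP1 // => /setP/(_ (phi y)).
rewrite !inE phiS //= (E2 (phi y) (phi y) (phi y)).1 => exy.
rewrite phiE // in exy.
by apply/setP => z; rewrite !inE ((E1 _ _ z).2 exy).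
Qed.

Lemma card_equivalence_partitionID (T : finType) (R : rel T) (S : {set T})
    (Q : pred T) : equivalence_rel R -> (forall x y, R x y -> Q x = Q y) ->
  #|equivalence_partition R S| =
    #|equivalence_partition R [set x in S | Q x]|
    + #|equivalence_partition R [set x in S | ~~ Q x]|.
Proof.
move=> ER RQ; set S1 := [set x in S | Q x]; set S2 := [set x in S | ~~ Q x].
have -> : equivalence_partition R S =
          equivalence_partition R S1 :|: equivalence_partition R S2.
  have {1}-> : S = S1 :|: S2 by apply/setP => x;
    rewrite !inE -andb_orr orbN andbT.
  rewrite /equivalence_partition imsetU; congr (_ :|: _);
    apply: eq_in_imset => x;
    rewrite inE => /andP[_ Qx]; apply/setP => y; rewrite !inE;
    by case Rxy: (R x y);
      rewrite ?andbF // -(RQ x y Rxy) ?Qx ?(negPf Qx) ?andbT ?andbF ?orbF.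
rewrite cardsU (_ : _ :&: _ = set0) ?cards0 ?subn0 //; apply/setP => A.
rewrite !inE; apply/andP => -[/imsetP[x + ->] /imsetP[y _ /setP/(_ x)]].
by rewrite !inE (ER x x x).1 andbT => /andP[-> ->].
Qed.

End CountingClasses.

(** * Isomorphisms between maps on different dart types *)

Section Relabelling.

Variables D1 D2 : finType.
Implicit Types (M : rmap D1) (N : rmap D2) (h : D1 -> D2).

Definition is_iso h M N : Prop :=
  [/\ bijective h, forall x, h (node_of M x) = node_of N (h x),
      forall x, h (edge_of M x) = edge_of N (h x) & h (root_of M) = root_of N].

Variables (h : D1 -> D2) (g : D2 -> D1).
Hypotheses (hK : cancel h g) (gK : cancel g h).

Definition relabel_perm (s : {perm D1}) : {perm D2} :=
  perm (inj_comp (inj_comp (can_inj hK) (@perm_inj _ s)) (can_inj gK)).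

Definition relabel M : rmap D2 :=
  (relabel_perm (node_of M), relabel_perm (edge_of M), h (root_of M)).

Lemma relabel_iso M : is_iso h M (relabel M).
Proof.
split=> [|x|x|] //; [by exists g | |];
  by rewrite /node_of /edge_of /= permE /= hK.
Qed.

End Relabelling.

Lemma is_iso_sym (D1 D2 : finType) h (M : rmap D1) (N : rmap D2) :
  is_iso h M N -> exists g, is_iso g N M.
Proof.
case=> -[g hK gK] hn he hr; exists g; split=> [|x|x|]; first by exists h.
- by rewrite -{1}[x]gK -hn hK.
- by rewrite -{1}[x]gK -he hK.
- by rewrite -hr hK.
Qed.

Lemma is_iso_comp (D1 D2 D3 : finType) h h'
    (M1 : rmap D1) (M2 : rmap D2) (M3 : rmap D3) :
  is_iso h M1 M2 -> is_iso h' M2 M3 -> is_iso (h' \o h) M1 M3.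
Proof.
case=> bh hn he hr [bh' hn' he' hr']; split=> [|x|x|] /=.
- exact: bij_comp.
- by rewrite hn hn'.
- by rewrite he he'.
- by rewrite hr hr'.
Qed.

Lemma isomorphicP (D : finType) (M N : rmap D) :
  reflect (exists h, is_iso h M N) (isomorphic M N).
Proof.
apply: (iffP existsP) =>
  [[p /and3P[/eqP nN /eqP eN /eqP rN]] | [h [bh hn he hr]]].
  exists p; split=> [|x|x|]; rewrite ?nN ?eN ?permJ ?rN //.
  by exists (p^-1)%g; [apply: permK | apply: permKV].
exists (perm (bij_inj bh)); rewrite permE hr eqxx andbT; apply/andP.
by split; apply/eqP/permP => x; rewrite -[x](permKV (perm (bij_inj bh))) permJ;
  rewrite [in RHS]permE permE ?hn ?he.
Qed.

Definition iso_invariant (K : map_class) : Prop :=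
  forall D1 D2 h (M : rmap D1) (N : rmap D2), is_iso h M N -> K D1 M = K D2 N.

(** [count_maps] for an arbitrary type of darts, so that surgeries can be counted on [D + dart6]; on
    ordinals the two are convertible. *)
Definition iso_classes (K : map_class) (D : finType) : nat :=
  #|equivalence_partition (@isomorphic D) [set M : rmap D | K D M]|.

Lemma iso_classes_eq (K1 K2 : map_class) D :
  K1 D =1 K2 D -> iso_classes K1 D = iso_classes K2 D.
Proof.
by move=> eK; congr #|equivalence_partition _ _|; apply/setP => M;
  rewrite !inE eK.
Qed.

Lemma iso_classes0 (K : map_class) D : K D =1 xpred0 -> iso_classes K D = 0.
Proof.
move=> K0; apply/eqP; rewrite cards_eq0 /equivalence_partition.
rewrite (_ : [set M | _] = set0) ?imset0 //.
by apply/setP => M; rewrite !inE K0.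
Qed.

Lemma iso_classes_empty (K : map_class) (D : finType) :
  #|D| = 0 -> iso_classes K D = 0.
Proof.
by move=> D0; apply: iso_classes0 => M; have := fintype0 (root_of M) D0.
Qed.

Lemma iso_classesID (K Q : map_class) D : iso_invariant Q ->
  iso_classes K D = iso_classes (fun D M => K D M && Q D M) D
                + iso_classes (fun D M => K D M && ~~ Q D M) D.
Proof.
move=> iQ; rewrite /iso_classes.
rewrite (@card_equivalence_partitionID _ _ _ (Q D) (@isomorphic_equivalence D)).
  by congr (_ + _); rewrite /iso_classes; congr #|equivalence_partition _ _|;
    apply/setP => M; rewrite !inE.
by move=> M N /isomorphicP[h /iQ].
Qed.

Lemma bijection_of_card (D1 D2 : finType) : #|D1| = #|D2| ->
  exists h : D1 -> D2, exists g, cancel h g /\ cancel g h.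
Proof.
move=> eqD; exists (fun x => enum_val (cast_ord eqD (enum_rank x))).
exists (fun x => enum_val (cast_ord (esym eqD) (enum_rank x))).
by split=> x; rewrite enum_valK ?cast_ordK ?cast_ordKV enum_rankK.
Qed.

Lemma iso_classes_card (K : map_class) (D1 D2 : finType) : iso_invariant K ->
  #|D1| = #|D2| -> iso_classes K D1 = iso_classes K D2.
Proof.
move=> iK /bijection_of_card[h [g [hK gK]]].
apply: (card_equivalence_partition (phi := relabel hK gK));
  try exact: isomorphic_equivalence.
- by move=> M; rewrite !inE (iK _ _ _ _ _ (relabel_iso hK gK M)).
- move=> M N _ _; have iM := relabel_iso hK gK M;
  have iN := relabel_iso hK gK N.
  apply/isomorphicP/isomorphicP => -[p ip].
    have [q iq] := is_iso_sym iN.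
    by eexists; apply: is_iso_comp (is_iso_comp iM ip) iq.
  have [q iq] := is_iso_sym iM.
  by eexists; apply: is_iso_comp (is_iso_comp iq ip) iN.
- move=> N; rewrite inE => KN; have iN := relabel_iso gK hK N.
  exists (relabel gK hK N); first by rewrite inE -(iK _ _ _ _ _ iN).
  apply/isomorphicP; have iN' := relabel_iso hK gK (relabel gK hK N).
  by have [q iq] := is_iso_sym (is_iso_comp iN iN'); exists q.
Qed.

Section IsoInvariants.

Variables (D1 D2 : finType) (h : D1 -> D2) (M : rmap D1) (N : rmap D2).
Hypothesis iMN : is_iso h M N.

Lemma is_iso_inj : injective h.
Proof. by case: iMN => /bij_inj. Qed.

Lemma is_iso_onto y : exists x, y = h x.
Proof. by case: iMN => -[g _ gK] _ _ _; exists (g y); rewrite gK. Qed.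

Lemma is_iso_node x : node_of N (h x) = h (node_of M x).
Proof. by case: iMN. Qed.

Lemma is_iso_edge x : edge_of N (h x) = h (edge_of M x).
Proof. by case: iMN. Qed.

Lemma is_iso_root : root_of N = h (root_of M).
Proof. by case: iMN. Qed.

Lemma is_iso_face x : face_of N (h x) = h (face_of M x).
Proof. by rewrite !faceE is_iso_edge is_iso_node. Qed.

Lemma is_iso_porbit x :
  porbit (node_of N) (h x) = h @: porbit (node_of M) x.
Proof.
have X i y : (node_of N ^+ i)%g (h y) = h ((node_of M ^+ i)%g y).
  by elim: i => [|i IHi]; rewrite ?perm1 // !expgSr !permM IHi is_iso_node.
apply/setP => y; apply/porbitP/imsetP => [[i ->]|[_ /porbitP[i ->] ->]].
  by rewrite X; exists ((node_of M ^+ i)%g x); rewrite ?mem_porbit.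
by exists i; rewrite X.
Qed.

Lemma is_iso_mem x y :
  (h y \in porbit (node_of N) (h x)) = (y \in porbit (node_of M) x).
Proof. by rewrite is_iso_porbit mem_imset //; apply: is_iso_inj. Qed.

Lemma is_iso_degree x : degree N (h x) = degree M x.
Proof. by rewrite /degree is_iso_porbit card_imset //; apply: is_iso_inj. Qed.

Lemma is_iso_good : good M -> good N.
Proof.
move=> gM; split=> [y|y|y|P Pr Pn Pe y|]; try have [x ->] := is_iso_onto y.
- by rewrite !is_iso_edge good_edge.
- by rewrite !is_iso_face good_face.
- by rewrite is_iso_edge is_iso_mem good_loop.
- apply: (good_conn gM (P := fun x => P (h x))) => [|z|z].
  + by rewrite -is_iso_root.
  + by rewrite -is_iso_node; apply: Pn.
  + by rewrite -is_iso_edge; apply: Pe.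
- have -> : porbits (node_of N) = (fun A : {set D1} =>
  h @: A) @: porbits (node_of M).
    apply/setP => A; apply/imsetP/imsetP => [[y _ ->]|[_ /imsetP[x _ ->] ->]].
      have [x ->] := is_iso_onto y.
      by exists (porbit (node_of M) x); rewrite ?is_iso_porbit ?imset_f.
    by exists (h x); rewrite ?is_iso_porbit.
  rewrite card_imset ?good_euler //; last exact/imset_inj/is_iso_inj.
  by case: iMN => bh _ _ _; rewrite (bij_eq_card bh).
Qed.

End IsoInvariants.

(** * Moving the root: reversal and rotation in its face *)

Section Reroot.

Variable D : finType.
Implicit Types M N : rmap D.

Definition reroot M x : rmap D := (node_of M, edge_of M, x).
Definition flip M : rmap D := reroot M (edge_of M (root_of M)).
Definition turn M : rmap D := reroot M (face_of M (root_of M)).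

Lemma reroot_good M x : good M -> good (reroot M x).
Proof.
move=> gM; case: (gM) => eK fK lM cM vM; split=> // P Px Pn Pe.
exact: (dart_connected_from eK cM Px Pn Pe).
Qed.

Lemma reroot_goodE M x : good_map (reroot M x) = good_map M.
Proof.
apply/goodP/goodP => [gM|]; last exact: reroot_good.
by case: M gM => -[n e] r /(reroot_good r).
Qed.

Lemma flipK M : good M -> flip (flip M) = M.
Proof. by case: M => -[n e] r gM; congr (_, _); apply: (good_edge gM). Qed.

Lemma turnK M : good M -> turn (turn (turn M)) = M.
Proof. by case: M => -[n e] r gM; congr (_, _); apply: (good_face gM). Qed.

End Reroot.

Lemma is_iso_reroot (D1 D2 : finType) h (M : rmap D1) (N : rmap D2) x y :
  is_iso h M N -> h x = y -> is_iso h (reroot M x) (reroot N y).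
Proof. by case. Qed.

Lemma is_iso_flip (D1 D2 : finType) h (M : rmap D1) (N : rmap D2) :
  is_iso h M N -> is_iso h (flip M) (flip N).
Proof.
move=> iMN; apply: is_iso_reroot (iMN) _.
by rewrite (is_iso_root iMN) (is_iso_edge iMN).
Qed.

Lemma is_iso_turn (D1 D2 : finType) h (M : rmap D1) (N : rmap D2) :
  is_iso h M N -> is_iso h (turn M) (turn N).
Proof.
move=> iMN; apply: is_iso_reroot (iMN) _.
by rewrite (is_iso_root iMN) (is_iso_face iMN).
Qed.

Lemma isomorphic_flip (D : finType) (M N : rmap D) :
  isomorphic M N -> isomorphic (flip M) (flip N).
Proof. by case/isomorphicP=> h /is_iso_flip i; apply/isomorphicP; exists h. Qed.

Lemma isomorphic_turn (D : finType) (M N : rmap D) :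
  isomorphic M N -> isomorphic (turn M) (turn N).
Proof. by case/isomorphicP=> h /is_iso_turn i; apply/isomorphicP; exists h. Qed.

Lemma iso_classes_flip (K : map_class) (D : finType) :
    (forall M : rmap D, K D M -> good_map M) ->
  iso_classes (fun D M => K D (flip M)) D = iso_classes K D.
Proof.
move=> gK.
have gflip M : K D (flip M) -> good M by move/gK;
  rewrite reroot_goodE => /goodP.
apply: (card_equivalence_partition (phi := @flip D));
  try exact: isomorphic_equivalence.
- by move=> M; rewrite !inE.
- move=> M N; rewrite !inE => /gflip gM /gflip gN; apply/idP/idP.
    by move/isomorphic_flip; rewrite !flipK.
  exact: isomorphic_flip.
- move=> M; rewrite inE => KM; have /goodP gM := gK M KM.
  exists (flip M); first by rewrite inE flipK.
  by rewrite flipK // (isomorphic_equivalence M M M).1.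
Qed.

Lemma iso_classes_turn (K : map_class) (D : finType) :
    (forall M : rmap D, K D M -> good_map M) ->
  iso_classes (fun D M => K D (turn M)) D = iso_classes K D.
Proof.
move=> gK.
have gturn M : K D (turn M) -> good M by move/gK;
  rewrite reroot_goodE => /goodP.
apply: (card_equivalence_partition (phi := @turn D));
  try exact: isomorphic_equivalence.
- by move=> M; rewrite !inE.
- move=> M N; rewrite !inE => /gturn gM /gturn gN; apply/idP/idP.
    by move/isomorphic_turn/isomorphic_turn; rewrite !turnK.
  exact: isomorphic_turn.
- move=> M; rewrite inE => KM; have /goodP gM := gK M KM.
  exists (turn (turn M)); first by rewrite inE turnK.
  by rewrite turnK // (isomorphic_equivalence M M M).1.
Qed.

(** * Inserting a vertex of degree 2 or 3 *)

Section PermSum.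

Variables D E : finType.
Implicit Types (s : {perm D}) (t : {perm E}).

Definition sum_fun s t (x : D + E) : D + E :=
  match x with inl a => inl (s a) | inr z => inr (t z) end.

Lemma sum_fun_inj s t : injective (sum_fun s t).
Proof. by move=> [x|x] [y|y] //= [/perm_inj->]. Qed.

Definition perm_sum s t : {perm D + E} := perm (@sum_fun_inj s t).

Lemma perm_suml s t a : perm_sum s t (inl a) = inl (s a).
Proof. by rewrite permE. Qed.

Lemma perm_sumr s t z : perm_sum s t (inr z) = inr (t z).
Proof. by rewrite permE. Qed.

(** A permutation that permutes the new darts among themselves must, by injectivity, preserve the
    old ones. This is how both maps and isomorphisms descend to the old darts. *)
Lemma perm_sum_split (u : {perm D + E}) t :
  (forall z, u (inr z) = inr (t z)) -> exists s, u = perm_sum s t.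
Proof.
move=> ut.
have ul a : exists b, u (inl a) = inl b.
  case ua: (u (inl a)) => [b|z]; first by exists b.
  have : inl a = inr ((t^-1)%g z) :> D + E.
    by apply: (@perm_inj _ u); rewrite ua ut permKV.
  by [].
pose s a := if u (inl a) is inl b then b else a.
have us a : u (inl a) = inl (s a) by rewrite /s; have [b ->] := ul a.
have s_inj : injective s.
  by move=> a b sab; have := us a; rewrite sab -us => /perm_inj[].
exists (perm s_inj); apply/permP => -[a|z]; last by rewrite perm_sumr ut.
by rewrite perm_suml permE us.
Qed.

Lemma perm_sum_injl t : injective (perm_sum^~ t).
Proof.
move=> s s' /permP eqs; apply/permP => a.
by have := eqs (inl a); rewrite !perm_suml => -[].
Qed.

Lemma perm_sum_conj s s' t :
  (perm_sum s t ^ perm_sum s' 1 = perm_sum (s ^ s') t)%g.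
Proof.
apply/permP => x; rewrite -[x](permKV (perm_sum s' 1)) permJ.
by case: (_ x) => [a|z]; rewrite ?perm_suml ?perm_sumr ?perm1 ?permJ ?perm_sumr.
Qed.

End PermSum.

Section Attachment.

Variables (D E : finType) (n : {perm D}) (n' : {perm D + E}).
Variables (att : E -> option D) (u : E).

Definition old_dart (x : D + E) : option D :=
  match x with inl a => Some a | inr z => att z end.

Definition same_vertex (x y : D + E) : bool :=
  match old_dart x, old_dart y with
  | Some a, Some b => b \in porbit n a
  | None, None => true
  | _, _ => false
  end.

(* The cycles of n' are those of n, with each new dart z joining the cycle of *)
(* [att z], plus one cycle consisting of the new darts that are not attached. *)
Definition attached : Prop :=
  att u = None /\ forall x y, (y \in porbit n' x) = same_vertex x y.

Lemma same_vertex_trans x y z :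
  same_vertex x y -> same_vertex y z -> same_vertex x z.
Proof.
rewrite /same_vertex;
  case: (old_dart x) (old_dart y) (old_dart z) => [a|] [b|] [c|] //.
by move=> ba cb; apply: porbit_trans cb ba.
Qed.

(** The second premise keeps the cycles of [n'] from being too large: one step never leaves a class
    of [same_vertex]. The remaining ones keep them from being too small: every member of a class is
    reached from a chosen one. *)
Lemma attachedI :
    att u = None ->
    (forall x, same_vertex x (n' x)) ->
    (forall a, inl (n a) \in porbit n' (inl a)) ->
    (forall z a, att z = Some a -> inr z \in porbit n' (inl a)) ->
    (forall z, att z = None -> inr z \in porbit n' (inr u)) ->
  attached.
Proof.
move=> attu same_n' oldn newS newN; split=> // x y; apply/idP/idP.
  elim/porbit_ind: y / => [|y]; last by move/same_vertex_trans; apply.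
  by rewrite /same_vertex; case: (old_dart x) => // a; apply: porbit_id.
have old a b : b \in porbit n a -> inl b \in porbit n' (inl a).
  elim/porbit_ind: b / => [|b ab]; first exact: porbit_id.
  exact: porbit_trans (oldn b) ab.
have oldP z a : old_dart z = Some a -> z \in porbit n' (inl a).
  by case: z => [b [->]|z]; [apply: porbit_id | apply: newS].
have newP z : old_dart z = None -> z \in porbit n' (inr u).
  by case: z => // z; apply: newN.
rewrite /same_vertex; case Ex: (old_dart x) => [a|];
  case Ey: (old_dart y) => [b|] //.
  move=> /old ba; apply: porbit_trans (oldP _ _ Ey) (porbit_trans ba _).
  by rewrite porbit_sym oldP.
by move=> _; apply: porbit_trans (newP _ Ey) _; rewrite porbit_sym newP.
Qed.

Hypothesis att_n : attached.

Lemma attached_mem x y : (y \in porbit n' x) = same_vertex x y.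
Proof. by case: att_n. Qed.

Lemma card_porbits_attached : #|porbits n'| = #|porbits n|.+1.
Proof.
pose lift_vertex (o : option {set D}) : {set D + E} :=
  [set x | match o, old_dart x with
           | Some A, Some a => a \in A
           | None, None => true
           | _, _ => false end].
have lift_some a : lift_vertex (Some (porbit n a)) = porbit n' (inl a).
  by apply/setP => x; rewrite !inE attached_mem /same_vertex.
have lift_none : lift_vertex None = porbit n' (inr u).
  by apply/setP => x; rewrite !inE attached_mem /same_vertex /= (proj1 att_n).
have -> : porbits n' = lift_vertex @: (None |: Some @: porbits n).
  apply/setP => A; apply/imsetP/imsetP => [[x _ ->]|[o]]; last first.
    case/setU1P=> [->|/imsetP[_ /imsetP[a _ ->] ->]] ->.
      by exists (inr u).
    by exists (inl a).
  case Ex: (old_dart x) => [a|].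
    exists (Some (porbit n a)); first by rewrite inE !imset_f ?orbT.
    rewrite lift_some; apply/eqP; rewrite eq_porbit_mem attached_mem.
    by rewrite /same_vertex /= Ex porbit_id.
  exists None; rewrite ?setU11 // lift_none; apply/eqP.
  by rewrite eq_porbit_mem attached_mem /same_vertex /= Ex (proj1 att_n).
rewrite card_imset; last first.
  move=> [A|] [B|] // /setP eqAB.
  - by congr Some; apply/setP => a; have := eqAB (inl a); rewrite !inE.
  - by have := eqAB (inr u); rewrite !inE /= (proj1 att_n).
  - by have := eqAB (inr u); rewrite !inE /= (proj1 att_n).
rewrite cardsU1 card_imset; last exact: Some_inj.
by rewrite (_ : None \notin _) //; apply/imsetP => -[].
Qed.

Lemma card_porbit_attached (x : D + E) :
  #|porbit n' x| = (if old_dart x is Some a then #|porbit n a| else 0)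
                   + \sum_z same_vertex x (inr z).
Proof.
rewrite -sum1_card big_sumType /=; congr (_ + _); last first.
  by rewrite big_mkcond; apply: eq_bigr => z _; rewrite attached_mem; case: ifP.
under eq_bigl do rewrite attached_mem /same_vertex /=.
by case: (old_dart x) => [a|]; [apply: sum1_card | rewrite big_pred0].
Qed.

End Attachment.

(* The darts of three new edges: [(i, false)] and [(i, true)] are opposite.   *)
Definition dart6 : finType := (option bool * bool)%type.

Definition rev6 (z : dart6) : dart6 := (z.1, ~~ z.2).

Lemma rev6K : involutive rev6.
Proof. by case=> i b; rewrite /rev6 /= negbK. Qed.

Definition rev6_perm : {perm dart6} := perm (can_inj rev6K).

Lemma card_dart6 : #|dart6| = 6.
Proof. by rewrite card_prod card_option card_bool. Qed.

Lemma sum_dart6 (F : dart6 -> nat) :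
  \sum_z F z = F (None, false) + F (None, true) + F (Some true, false)
    + F (Some true, true) + F (Some false, false) + F (Some false, true).
Proof.
rewrite (eq_bigr (fun z => F (z.1, z.2))) => [|[] //].
rewrite -(pair_bigA _ (fun i b => F (i, b))) /= (bigD1 None) //=.
rewrite (reindex_omap Some id) /=; last by case.
under [X in _ + X = _]eq_bigl do rewrite eqxx.
rewrite !big_bool /=; lia.
Qed.

(** * Grafting three edges and one vertex onto a map *)

Section Graft.

Variables (D : finType) (rho : {perm dart6}) (tau : {perm (D + dart6)%type}).
Variable M : rmap D.
Local Notation n := (node_of M).
Local Notation e := (edge_of M).
Local Notation f := (face_of M).
Local Notation r := (root_of M).

(* [tau] exchanges sides of old faces with sides of the new triangles.        *)
Definition graft : rmap (D + dart6)%type :=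
  (((perm_sum e rev6_perm)^-1 * perm_sum f rho ^ tau)%g,
   perm_sum e rev6_perm, inr (Some true, false)).

Local Notation n' := (node_of graft).
Local Notation e' := (edge_of graft).
Local Notation f' := (face_of graft).

(** The rotation of [graft] is defined backwards from its edges and faces, so the faces are exactly
    the prescribed ones. *)
Lemma graft_face : f' = (perm_sum f rho ^ tau)%g.
Proof. exact: mulKVg. Qed.

Lemma graft_faceE x : f' (tau x) = tau (perm_sum f rho x).
Proof. by rewrite graft_face permJ. Qed.

Lemma graft_edgel a : e' (inl a) = inl (e a).
Proof. exact: perm_suml. Qed.

Lemma graft_edger z : e' (inr z) = inr (rev6 z).
Proof. by rewrite [e' _]perm_sumr permE. Qed.

Lemma graft_nodeE x : involutive e -> n' x = f' (e' x).
Proof.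
move=> eK; rewrite faceE; congr (n' _).
by case: x => [a|z]; rewrite ?graft_edgel ?graft_edger ?eK ?rev6K.
Qed.

Lemma graft_edgeK : involutive e' <-> involutive e.
Proof.
split=> eK x; first by have := eK (inl x); rewrite !graft_edgel => -[].
by case: x => [a|z]; rewrite ?graft_edgel ?graft_edger ?eK ?rev6K.
Qed.

Hypothesis rho3 : forall z, rho (rho (rho z)) = z.

Lemma graft_face3 : (forall x, f' (f' (f' x)) = x) <->
  (forall x, f (f (f x)) = x).
Proof.
split=> fK x.
  have := fK (tau (inl x)); rewrite !graft_faceE => /perm_inj.
  by rewrite !perm_suml => -[].
rewrite -[x](permKV tau) !graft_faceE; congr (tau _).
by case: (_ x) => [a|z]; rewrite ?perm_suml ?perm_sumr ?fK ?rho3.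
Qed.

Variable att : dart6 -> option D.
Local Notation same := (same_vertex n att).

Hypothesis att_in_v : att (Some true, true) = Some r.
Hypothesis att_rev : forall z, att z = None -> att (rev6 z) <> None.
Hypothesis att_near : forall P : pred D, P r -> (forall x, P x -> P (n x)) ->
  (forall x, P x -> P (e x)) -> forall z a, att z = Some a -> P a.
Hypothesis att_loopless : (forall x, e x \notin porbit n x) ->
  forall z, ~~ same (inr z) (inr (rev6 z)).
Hypothesis att_mem : involutive e -> (forall x, f (f (f x)) = x) ->
  attached n n' att (Some true, false).

(** One vertex and six darts are added, which preserves 6V = [#|D|] + 12. Faces stay triangles
    because [rho] has order dividing 3 and conjugation by [tau] does not change cycle lengths. Loops
    and connectedness are read off from the description of the vertices by [att]. *)
Lemma graft_good : good graft <-> good M.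
Proof.
split=> gM; have [eK fK lM cM vM] := gM; split=> //; try exact/graft_edgeK;
  try exact/graft_face3; have {}eK : involutive e by [exact/graft_edgeK | ];
  have {}fK : forall x, f (f (f x)) = x by [exact/graft_face3 | ];
  have mem := attached_mem (att_mem eK fK).
- by move=> x; have := lM (inl x); rewrite mem graft_edgel.
- move=> P Pr Pn Pe.
  (* Nothing is claimed on new darts. When [n'] steps from a new dart to an old one, [att_near]
     supplies [P] at the vertex to which the new dart is attached. *)
  pose P' (x : D + dart6) := if x is inl a then P a else true.
  suffices P'_ x : P' x by move=> x; apply: (P'_ (inl x)).
  apply: cM x => // [x|[x|z]]; rewrite ?graft_edgel ?graft_edger //=;
    last exact: Pe.
  have: n' x \in porbit n' x by apply: mem_porbit_image.
  rewrite mem /same_vertex /P'; case: (n' x) => // b.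
  case Ex: (old_dart att x) => [a|] //=.
  have Pa : P' x -> P a.
    by case: x Ex => [_ [<-]|z attz _] //=; apply: att_near attz.
  move=> ba /Pa {}Pa; exact: (porbit_ind (P := P) Pa Pn ba).
- have := vM; rewrite (card_porbits_attached (att_mem eK fK)) card_sum
  card_dart6; lia.
- move=> x; rewrite mem; case: x => [a|z]; first by rewrite graft_edgel lM.
  by rewrite graft_edger att_loopless.
- move=> P Pr Pn Pe; have Pmem x y : same x y -> P x -> P y.
    by rewrite -mem => xy Px; apply: (porbit_ind (P := P) Px Pn xy).
  have P_ x : P (inl x).
    apply: (cM (fun x => P (inl x))) => [|a Pa|a Pa] /=.
    + apply: Pmem (Pe _ Pr); rewrite graft_edger /same_vertex /= att_in_v.
      exact: porbit_id.
    + by apply: Pmem Pa; apply: mem_porbit_image.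
    + by rewrite -graft_edgel Pe.
  have Patt z a : att z = Some a -> P (inr z).
    by move=> Ez; apply: Pmem (P_ a); rewrite /same_vertex /= Ez porbit_id.
  move=> [x|z] //; case Ez: (att z) => [a|]; first exact: Patt Ez.
  case Ez': (att (rev6 z)) => [a|]; last by case: (att_rev Ez).
  (* A dart at the new vertex is reached from its reverse, which starts at an old vertex. *)
  by rewrite -[z]rev6K -graft_edger Pe // (Patt _ a).
- rewrite (card_porbits_attached (att_mem eK fK)) card_sum card_dart6; lia.
Qed.

End Graft.

(* The root edge leads from v to b.  The new vertex u is the origin of [dp],  *)
(* which leads to v, and of [dq], which leads to b.  For [insert_digon], [dw] *)
(* is a second edge from v to b; for [insert_star] it leads from u to the     *)
(* apex a of the root face.  Primes denote opposite darts.                    *)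
Notation dp := ((Some true, false) : dart6).
Notation dp' := ((Some true, true) : dart6).
Notation dq := ((Some false, false) : dart6).
Notation dq' := ((Some false, true) : dart6).
Notation dw := ((None, false) : dart6).
Notation dw' := ((None, true) : dart6).

(* Exchanging the root r with [dw] turns these two triangles into             *)
(* (r dq' dp) and (dw' dp' dq), and puts [dw] in place of r in its old face.  *)
Definition digon_rho_fun (z : dart6) : dart6 :=
  match z with
  | (None, false) => dq' | (Some false, true) => dp | (Some true, false) => dw
  | (None, true) => dp' | (Some true, true) => dq | (Some false, false) => dw'
  end.

Lemma digon_rho_inj : injective digon_rho_fun.
Proof.
apply: (@can_inj _ _ _ (digon_rho_fun \o digon_rho_fun)).
by move=> [[[]|] []].
Qed.

Definition digon_rho : {perm dart6} := perm digon_rho_inj.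

(* Exchanging f r with [dq'] and f (f r) with [dp] turns the root face        *)
(* (r, f r, f (f r)) and these two triangles into the faces (r dq' dp),       *)
(* (f r dw' dq) and (f (f r) dp' dw).                                         *)
Definition star_rho_fun (z : dart6) : dart6 :=
  match z with
  | (Some false, true) => dw' | (None, true) => dq | (Some false, false) => dq'
  | (Some true, false) => dp' | (Some true, true) => dw | (None, false) => dp
  end.

Lemma star_rho_inj : injective star_rho_fun.
Proof.
apply: (@can_inj _ _ _ (star_rho_fun \o star_rho_fun)).
by move=> [[[]|] []].
Qed.

Definition star_rho : {perm dart6} := perm star_rho_inj.

Lemma digon_rhoE z : digon_rho z = digon_rho_fun z.
Proof. exact: permE. Qed.

Lemma star_rhoE z : star_rho z = star_rho_fun z.
Proof. exact: permE. Qed.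

Lemma digon_rho3 z : digon_rho (digon_rho (digon_rho z)) = z.
Proof. by case: z => [[[]|] []]; rewrite !permE. Qed.

Lemma star_rho3 z : star_rho (star_rho (star_rho z)) = z.
Proof. by case: z => [[[]|] []]; rewrite !permE. Qed.

Section Insertion.

Variables (D : finType) (M : rmap D).
Local Notation n := (node_of M).
Local Notation e := (edge_of M).
Local Notation f := (face_of M).
Local Notation r := (root_of M).

Definition insert_digon : rmap (D + dart6)%type :=
  graft digon_rho (tperm (inl r) (inr dw)) M.

Definition digon_att (z : dart6) : option D :=
  match z with
  | (Some true, true) | (None, false) => Some r
  | (Some false, true) | (None, true) => Some (e r)
  | _ => None
  end.

Definition insert_star : rmap (D + dart6)%type :=
  graft star_rho
    (tperm (inl (f r)) (inr dq') * tperm (inl (f (f r))) (inr dp))%g M.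

Definition star_att (z : dart6) : option D :=
  match z with
  | (Some true, true) => Some r
  | (Some false, true) => Some (f r)
  | (None, true) => Some (f (f r))
  | _ => None
  end.

(** Goodness of [M] is itself concluded in [insert_digon_good] and [insert_star_good], so the
    computations rest on this mere nondegeneracy of the root face. *)
Hypothesis fr_neq : f r != r.

Section Digon.

Local Notation n' := (node_of insert_digon).
Local Notation e' := (edge_of insert_digon).
Local Notation f' := (face_of insert_digon).

Lemma digon_face_old x : x != r ->
  f' (inl x) = if f x == r then inr dw else inl (f x).
Proof.
move=> xr; have -> : inl x = tperm (inl r) (inr dw) (inl x) :> D + dart6.
  by rewrite tpermD // eq_sym; apply: contraNneq xr => -[->].
rewrite graft_faceE perm_suml; case: eqP => [-> | fxr]; first by rewrite tpermL.
by rewrite tpermD //; apply/eqP => -[/esym].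
Qed.

Lemma digon_face_root : f' (inl r) = inr dq'.
Proof.
by rewrite -[inl r](tpermR _ (inr dw)) graft_faceE perm_sumr digon_rhoE /=
  tpermD.
Qed.

Lemma digon_face_new z :
  f' (inr z) = match z with
               | (None, false) => inl (f r) | (Some true, false) => inl r
               | _ => inr (digon_rho_fun z) end.
Proof.
have [-> | zw] := eqVneq z dw.
  rewrite -(tpermL (inl r) (inr dw)) graft_faceE perm_suml tpermD //.
  by rewrite eq_sym; apply: contraNneq fr_neq => -[->].
have -> : inr z = tperm (inl r) (inr dw) (inr z) :> D + dart6.
  by rewrite tpermD // eq_sym; apply: contraNneq zw => -[->].
rewrite graft_faceE perm_sumr digon_rhoE.
by case: z zw => [[[]|] []] //= _; rewrite ?tpermR // tpermD.
Qed.

Hypothesis eK : involutive e.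

Lemma digon_node_old x :
  n' (inl x) = if x == e r then inr dq' else
               if n x == r then inr dw else inl (n x).
Proof.
rewrite graft_nodeE // graft_edgel -(inj_eq (inv_inj eK)) eK.
by case: eqP => [->|/eqP exr];
  rewrite ?digon_face_root ?digon_face_old // faceE eK.
Qed.

Lemma digon_node_new z :
  n' (inr z) = match z with
               | (None, false) => inr dp' | (Some true, true) => inl r
               | (Some false, true) => inr dw' | (None, true) => inl (f r)
               | (Some true, false) => inr dq
               | (Some false, false) => inr dp end.
Proof.
by rewrite graft_nodeE // graft_edger digon_face_new; case: z => [[[]|] []].
Qed.

Lemma digon_attached : attached n n' digon_att dp.
Proof.
have fr : f r = n (e r) by rewrite faceE.
have Ew : inr dw \in porbit n' (inl r).
  rewrite porbit_sym; apply: (porbit_trans (y := inr dp'));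
    by apply: porbit_step; rewrite digon_node_new.
have Ep' : inr dp' \in porbit n' (inl r).
  by rewrite porbit_sym; apply: porbit_step; rewrite digon_node_new.
have Eq' : inr dq' \in porbit n' (inl (e r)).
  by apply: porbit_step; rewrite digon_node_old eqxx.
have Ew' : inr dw' \in porbit n' (inl (e r)).
  apply: porbit_trans Eq'; apply: porbit_step;
    by rewrite digon_node_new.
apply: attachedI => // [x|a|z a|z].
- case: x => [a|z].
    rewrite digon_node_old; case: eqP => [->|_]; first exact: porbit_id.
    have na : n a \in porbit n a by apply: mem_porbit_image.
    by case: eqP => [nar|_]; rewrite /same_vertex //= -nar.
  rewrite digon_node_new; case: z => [[[]|] []] //=;
    rewrite /same_vertex /= ?porbit_id //.
  by rewrite fr mem_porbit_image.
- have [->|ar] := eqVneq a (e r).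
    apply: porbit_trans Ew'; rewrite -fr.
    by apply: porbit_step; rewrite digon_node_new.
  have := mem_porbit_image n' (inl a); rewrite digon_node_old (negPf ar).
  by case: eqP => // -> ; apply: porbit_trans; rewrite porbit_sym.
- by case: z => [[[]|] []] //= [<-].
- case: z => [[[]|] []] //= _; first exact: porbit_id.
  apply: porbit_step;
    by rewrite digon_node_new.
Qed.

End Digon.

Lemma insert_digon_good : good insert_digon <-> good M.
Proof.
apply: (graft_good digon_rho3 (att := digon_att)) => //.
- by case=> [[[]|] []].
- by move=> P Pr Pn Pe [[[]|] []] //= a [<-] //; apply: Pe.
- move=> lM [[[]|] []] //=; rewrite /same_vertex //= ?lM // porbit_sym //.
- by move=> eK _; apply: digon_attached.
Qed.

Section Star.

Local Notation n' := (node_of insert_star).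
Local Notation e' := (edge_of insert_star).
Local Notation f' := (face_of insert_star).
Local Notation s := (f r).
Local Notation t := (f (f r)).
Local Notation tau := (tperm (inl s) (inr dq') * tperm (inl t) (inr dp))%g.

Hypothesis fK : forall x, f (f (f x)) = x.

Let ts_neq : t != s.
Proof. by rewrite (inj_eq perm_inj). Qed.

Let tr_neq : t != r.
Proof. by rewrite -{2}(fK r) !(inj_eq perm_inj) eq_sym. Qed.

Let inl_neq (x y : D) : x != y -> inl x != inl y :> D + dart6.
Proof. by apply: contraNneq => -[->]. Qed.

Let inr_neq (x y : dart6) : x != y -> inr x != inr y :> D + dart6.
Proof. by apply: contraNneq => -[->]. Qed.

Lemma star_tau_old x :
  tau (inl x) = if x == s then inr dq' else if x == t then inr dp else inl x.
Proof.
rewrite permM; have [->|xs] := eqVneq x s; first by rewrite tpermL tpermD.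
have sx : inl s != inl x :> D + dart6 by apply: inl_neq; rewrite eq_sym.
rewrite (tpermD sx) //; have [->|xt] := eqVneq x t; first by rewrite tpermL.
have tx : inl t != inl x :> D + dart6 by apply: inl_neq; rewrite eq_sym.
by rewrite (tpermD tx).
Qed.

Lemma star_tau_new z :
  tau (inr z) = match z with
                | (Some false, true) => inl s | (Some true, false) => inl t
                | _ => inr z end.
Proof.
rewrite permM; case: z => [[[]|] []] /=; try by rewrite !tpermD //;
  apply: inr_neq.
  by rewrite (tpermD (z := inr dp)) // tpermR.
by rewrite tpermR tpermD //; apply: inl_neq.
Qed.

Lemma star_face_old x :
  f' (inl x) = if x == r then inr dq' else if x == s then inr dw' else
               if x == t then inr dp' else inl (f x).
Proof.
have [->|xr] := eqVneq x r.
  have -> : inl r = tau (inl r) :> D + dart6.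
    by rewrite star_tau_old ![r == _]eq_sym (negPf fr_neq) (negPf tr_neq).
  by rewrite graft_faceE perm_suml star_tau_old eqxx.
have [->|xs] := eqVneq x s.
  have -> : inl s = tau (inr dq') by rewrite star_tau_new.
  by rewrite graft_faceE perm_sumr star_rhoE star_tau_new.
have [->|xt] := eqVneq x t.
  have -> : inl t = tau (inr dp) by rewrite star_tau_new.
  by rewrite graft_faceE perm_sumr star_rhoE star_tau_new.
have -> : inl x = tau (inl x) :> D + dart6.
  by rewrite star_tau_old (negPf xs) (negPf xt).
by rewrite graft_faceE perm_suml star_tau_old !(inj_eq perm_inj) (negPf xr)
  (negPf xs).
Qed.

Lemma star_face_new z :
  f' (inr z) = match z with
               | (Some false, true) => inr dp | (Some true, false) => inl r
               | (None, true) => inr dq | (Some false, false) => inl s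
               | (Some true, true) => inr dw | (None, false) => inl t end.
Proof.
have [/eqP->|] := boolP (z == dq').
  have -> : inr dq' = tau (inl s) by rewrite star_tau_old eqxx.
  by rewrite graft_faceE perm_suml star_tau_old eqxx (negPf ts_neq).
have [/eqP-> _|] := boolP (z == dp).
  have -> : inr dp = tau (inl t) by rewrite star_tau_old (negPf ts_neq) eqxx.
  rewrite graft_faceE perm_suml star_tau_old fK ![r == _]eq_sym.
  by rewrite (negPf fr_neq) (negPf tr_neq).
move=> zp zq; have -> : inr z = tau (inr z) :> D + dart6.
  by rewrite star_tau_new; case: z zp zq => [[[]|] []].
rewrite graft_faceE perm_sumr star_rhoE star_tau_new.
by case: z zp zq => [[[]|] []].
Qed.

Hypothesis eK : involutive e.

Lemma star_node_old x :
  n' (inl x) = if e x == r then inr dq' else if e x == s then inr dw' else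
               if e x == t then inr dp' else inl (n x).
Proof.
by rewrite graft_nodeE // graft_edgel star_face_old [f (e x)]faceE eK.
Qed.

Lemma star_node_new z :
  n' (inr z) = match z with
               | (Some false, true) => inl s | (Some true, true) => inl r
               | (None, true) => inl t | (Some true, false) => inr dw
               | (None, false) => inr dq | (Some false, false) => inr dp end.
Proof.
by rewrite graft_nodeE // graft_edger star_face_new; case: z => [[[]|] []].
Qed.

Lemma star_attached : attached n n' star_att dp.
Proof.
have nE x : n x = f (e x) by rewrite faceE eK.
have Ep' : inr dp' \in porbit n' (inl r).
  by rewrite porbit_sym; apply: porbit_step; rewrite star_node_new.
have Eq' : inr dq' \in porbit n' (inl s).
  by rewrite porbit_sym; apply: porbit_step; rewrite star_node_new.
have Ew' : inr dw' \in porbit n' (inl t).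
  by rewrite porbit_sym; apply: porbit_step; rewrite star_node_new.
apply: attachedI => // [x|a|z a|z].
- case: x => [a|z].
    have := mem_porbit_image n a; rewrite star_node_old nE.
    case: eqP => [->|_]; first by [].
    case: eqP => [->|_]; first by [].
    by case: eqP => [->|_]; first by rewrite fK.
  rewrite star_node_new; case: z => [[[]|] []] //=;
    rewrite /same_vertex /= ?porbit_id //.
- have := mem_porbit_image n' (inl a); rewrite star_node_old nE.
  case: eqP => [->|_]; first by apply: porbit_trans; rewrite porbit_sym.
  case: eqP => [->|_]; first by apply: porbit_trans; rewrite porbit_sym.
  by case: eqP => [->|_] //; rewrite fK; apply: porbit_trans;
    rewrite porbit_sym.
- by case: z => [[[]|] []] //= [<-].
- have Ew : inr dw \in porbit n' (inr dp).
    apply: porbit_step;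
    by rewrite star_node_new.
  case: z => [[[]|] []] //= _; first exact: porbit_id.
  apply: porbit_trans Ew; apply: porbit_step;
    by rewrite star_node_new.
Qed.

End Star.

Lemma insert_star_good : good insert_star <-> good M.
Proof.
apply: (graft_good star_rho3 (att := star_att)) => //.
- by case=> [[[]|] []].
- move=> P Pr Pn Pe; have Pf x : P x -> P (f x) by move=> Px; rewrite faceE;
  apply/Pn/Pe.
  by move=> [[[]|] []] //= a [<-]; rewrite ?Pf ?Pr.
- by move=> lM [[[]|] []].
- by move=> eK fK; apply: star_attached.
Qed.

End Insertion.

Lemma relabel_isoV (D1 D2 : finType) (h : D1 -> D2) (g : D2 -> D1)
  (hK : cancel h g) (gK : cancel g h) (M : rmap D1) :
  is_iso g (relabel hK gK M) M.
Proof.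
split=> [|x|x|] /=; [by exists h | | | exact: hK];
  by rewrite /node_of /edge_of /= permE /= hK.
Qed.

(** The darts outside the image of [w] are as many as those of [D] and are named by them
    arbitrarily. Thus six chosen darts of a map can be given the names of [dart6]. *)
Lemma injection_extends (D E D' : finType) (w : E -> D') :
  injective w -> #|D'| = #|D| + #|E| ->
  exists h : D + E -> D', exists g,
    [/\ cancel h g, cancel g h & forall z, h (inr z) = w z].
Proof.
move=> w_inj cardD'; pose S := {x : D' | x \notin codom w}.
have cardS : #|D| = #|{: S}|.
  rewrite card_sig; apply/eqP; rewrite -(eqn_add2r #|E|) -cardD'.
  by rewrite -(card_codom w_inj) addnC cardC.
have [k [k' [kK k'K]]] := bijection_of_card cardS.
pose h (x : D + E) := match x with inl a => val (k a) | inr z => w z end.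
have h_inj : injective h.
  have kw a z : val (k a) <> w z.
    by move=> E1; have := valP (k a); rewrite E1 codom_f.
  move=> [a|z] [b|y] /=; [|by move/kw|by move/esym/kw|by move/w_inj->].
  by move/val_inj/(can_inj kK)->.
have [|g hK gK] := inj_card_bij h_inj; first by rewrite card_sum cardD'.
by exists h, g.
Qed.

Lemma map_eqP (D : finType) (M N : rmap D) :
  edge_of M = edge_of N -> face_of M = face_of N ->
  root_of M = root_of N -> M = N.
Proof.
case: M N => [[n e] r] [[n' e'] r'].
rewrite /face_of /edge_of /node_of /root_of /= => -> /mulgI-> ->.
by [].
Qed.

(** * Insertions respect and reflect isomorphism *)

Section Act.

Variable D : finType.
Implicit Types (M N : rmap D) (p : {perm D}).

Definition act M p : rmap D :=
  ((node_of M ^ p)%g, (edge_of M ^ p)%g, p (root_of M)).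

Lemma act_iso M p : is_iso p M (act M p).
Proof.
by split=> [|x|x|] //; rewrite ?permJ //; exists (p^-1)%g;
  [apply: permK | apply: permKV].
Qed.

Lemma isomorphic_act M N : reflect (exists p, N = act M p) (isomorphic M N).
Proof.
apply: (iffP existsP) => [[p /and3P[/eqP nN /eqP eN /eqP rN]]|[p ->]]; exists p.
  by rewrite /act -nN -eN -rN; case: N {nN eN rN} => -[].
by rewrite /act !eqxx.
Qed.

Lemma face_act M p : face_of (act M p) = (face_of M ^ p)%g.
Proof. by rewrite /face_of conjMg. Qed.

Lemma graft_act rho tau tau' M p : tau' = (tau ^ perm_sum p 1)%g ->
  graft rho tau' (act M p) =
    ((node_of (graft rho tau M) ^ perm_sum p 1)%g,
     (edge_of (graft rho tau M) ^ perm_sum p 1)%g,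
     perm_sum p 1%g (root_of (graft rho tau M))).
Proof.
move=> ->; rewrite {1}/graft face_act -!perm_sum_conj -conjVg -conjJg -conjMg.
by rewrite /= perm_sumr perm1.
Qed.

(** Once [tau] is undone, edges and faces both preserve the new darts, so [perm_sum_split] extracts
    those of [M]. The root [r0] is free because [graft] itself always has root [dp]; it is fixed
    later through [tau]. *)
Lemma graft_surj (M' : rmap (D + dart6)%type) (rho : {perm dart6})
    (tau : {perm (D + dart6)%type}) r0 :
    root_of M' = inr dp ->
    (forall z, edge_of M' (inr z) = inr (rev6 z)) ->
    (forall z, (face_of M' ^ tau^-1)%g (inr z) = inr (rho z)) ->
  exists M : rmap D, [/\ root_of M = r0, M' = graft rho tau M
    & face_of M' = (perm_sum (face_of M) rho ^ tau)%g].
Proof.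
move=> rM' eM' /perm_sum_split[f f_eq].
have /perm_sum_split[e e_eq] : forall z, edge_of M' (inr z) = inr (rev6_perm z).
  by move=> z; rewrite eM' permE.
exists ((e^-1 * f)%g, e, r0).
have -> : face_of ((e^-1 * f)%g, e, r0) = f by apply: mulKVg.
have fM' : face_of M' = (perm_sum f rho ^ tau)%g by rewrite -f_eq conjgKV.
split=> //; apply: map_eqP; rewrite ?e_eq ?rM' //.
by rewrite graft_face fM'; congr (perm_sum _ _ ^ _)%g; rewrite -[LHS](mulKVg e).
Qed.

End Act.

Section DigonClasses.

Variable D : finType.
Implicit Types M N : rmap D.

Lemma insert_digon_act M p :
  insert_digon (act M p) = act (insert_digon M) (perm_sum p 1%g).
Proof.
apply: graft_act; rewrite tpermJ perm_suml perm_sumr perm1.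
by [].
Qed.

(** The old root is the successor of [dp] in its face, so it can be recovered; it determines [tau],
    and conjugation by [tau] is then undone. *)
Lemma insert_digon_inj M N : good M -> good N ->
  insert_digon M = insert_digon N -> M = N.
Proof.
move=> gM gN eqMN.
have eq_root : root_of M = root_of N.
  have := digon_face_new (face_neq gM _) dp; rewrite eqMN.
  by rewrite digon_face_new ?(face_neq gN) // => -[].
apply: map_eqP => //.
  exact: (perm_sum_injl (congr1 (@edge_of _) eqMN)).
have := congr1 (@face_of _) eqMN; rewrite !graft_face eq_root.
by move/(can_inj (conjgK _))/perm_sum_injl.
Qed.

(** An isomorphism fixes the root [dp], and all other new darts are reached from it by reversals and
    rotations that stay among new darts. *)
Lemma insert_digon_rigid M N (p : D + dart6 -> D + dart6) : good M -> good N ->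
  is_iso p (insert_digon M) (insert_digon N) -> forall z, p (inr z) = inr z.
Proof.
move=> gM gN iMN.
have hr z : p (inr z) = inr z -> p (inr (rev6 z)) = inr (rev6 z).
  have eM : edge_of (insert_digon M) (inr z) = inr (rev6 z)
    by apply: graft_edger.
  by move=> pz; rewrite -eM -(is_iso_edge iMN) pz graft_edger.
have hn z z' : node_of (insert_digon M) (inr z) = inr z' ->
    node_of (insert_digon N) (inr z) = inr z' ->
    p (inr z) = inr z -> p (inr z') = inr z'.
  by move=> <- nN pz; rewrite -(is_iso_node iMN) pz nN.
have nM := digon_node_new (face_neq gM _) (good_edge gM).
have nN := digon_node_new (face_neq gN _) (good_edge gN).
have hp : p (inr dp) = inr dp by have := is_iso_root iMN.
have hq := hn dp dq (nM _) (nN _) hp; have hq' := hr _ hq.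
have hw' := hn dq' dw' (nM _) (nN _) hq'.
by move=> [[[]|] []] //; [apply: hr hp | apply: hr hw'].
Qed.

End DigonClasses.

Section StarClasses.

Variable D : finType.
Implicit Types M N : rmap D.

Lemma insert_star_act M p :
  insert_star (act M p) = act (insert_star M) (perm_sum p 1%g).
Proof.
apply: graft_act; rewrite conjMg !tpermJ !perm_suml !perm_sumr !perm1.
by rewrite !face_act !permJ.
Qed.

Lemma insert_star_inj M N : good M -> good N ->
  insert_star M = insert_star N -> M = N.
Proof.
move=> gM gN eqMN.
have fM := star_face_new (face_neq gM _) (good_face gM).
have fN := star_face_new (face_neq gN _) (good_face gN).
have inl_eq z a b : face_of (insert_star M) (inr z) = inl a ->
    face_of (insert_star N) (inr z) = inl b -> a = b.
  by rewrite eqMN => -> [].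
have eq_r := inl_eq dp _ _ (fM _) (fN _).
have eq_s := inl_eq dq _ _ (fM _) (fN _).
have eq_t := inl_eq dw _ _ (fM _) (fN _).
apply: map_eqP => //.
  exact: (perm_sum_injl (congr1 (@edge_of _) eqMN)).
have := congr1 (@face_of _) eqMN; rewrite !graft_face eq_t eq_s.
by move/(can_inj (conjgK _))/perm_sum_injl.
Qed.

Lemma insert_star_rigid M N (p : D + dart6 -> D + dart6) : good M -> good N ->
  is_iso p (insert_star M) (insert_star N) -> forall z, p (inr z) = inr z.
Proof.
move=> gM gN iMN.
have hr z : p (inr z) = inr z -> p (inr (rev6 z)) = inr (rev6 z).
  have eM : edge_of (insert_star M) (inr z) = inr (rev6 z)
    by apply: graft_edger.
  by move=> pz; rewrite -eM -(is_iso_edge iMN) pz graft_edger.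
have hn z z' : node_of (insert_star M) (inr z) = inr z' ->
    node_of (insert_star N) (inr z) = inr z' ->
    p (inr z) = inr z -> p (inr z') = inr z'.
  by move=> <- nN pz; rewrite -(is_iso_node iMN) pz nN.
have nM := star_node_new (face_neq gM _) (good_face gM) (good_edge gM).
have nN := star_node_new (face_neq gN _) (good_face gN) (good_edge gN).
have hp : p (inr dp) = inr dp by have := is_iso_root iMN.
have hw := hn dp dw (nM _) (nN _) hp; have hq := hn dw dq (nM _) (nN _) hw.
by move=> [[[]|] []] //; [apply: hr hp | apply: hr hq | apply: hr hw].
Qed.

End StarClasses.

Section InsertionClasses.

Variables (D : finType) (op : rmap D -> rmap (D + dart6)%type).
Hypothesis op_act : forall M p, op (act M p) = act (op M) (perm_sum p 1%g).
Hypothesis op_inj : forall M N, good M -> good N -> op M = op N -> M = N.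
Hypothesis op_rigid : forall M N p, good M -> good N ->
  is_iso p (op M) (op N) -> forall z, p (inr z) = inr z.

(** By rigidity an isomorphism of the enlarged maps fixes the new darts, hence comes from a
    permutation of the old ones; naturality and injectivity conclude. *)
Lemma insertion_isomorphic M N : good M -> good N ->
  isomorphic (op M) (op N) = isomorphic M N.
Proof.
move=> gM gN; apply/isomorphic_act/isomorphic_act => -[p]; last first.
  by move=> ->; exists (perm_sum p 1%g); apply: op_act.
move=> eqN; have [p0 p_eq] : exists p0, p = perm_sum p0 1%g.
  apply: perm_sum_split => z; rewrite perm1.
  by apply: op_rigid gM gN _ z; rewrite eqN; apply: act_iso.
exists p0; apply: op_inj => //; last by rewrite op_act -p_eq.
exact: is_iso_good (act_iso M p0) gM.
Qed.

Variables (K1 K2 : map_class) (D' : finType).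
Hypothesis cardD' : #|D'| = #|D| + 6.
Hypothesis K2_inv : iso_invariant K2.
Hypothesis K1_good : forall M : rmap D, K1 M -> good M.
Hypothesis op_K : forall M, good M -> K2 (op M) = K1 M.
Hypothesis op_onto : forall M' : rmap (D + dart6)%type, K2 M' ->
  exists M h, good M /\ is_iso h (op M) M'.

Lemma iso_classes_insertion : iso_classes K2 D' = iso_classes K1 D.
Proof.
have -> : iso_classes K2 D' = iso_classes K2 (D + dart6)%type.
  by apply: iso_classes_card; rewrite ?card_sum ?card_dart6.
apply/esym/(card_equivalence_partition (phi := op));
  try exact: isomorphic_equivalence.
- by move=> M; rewrite !inE => KM; rewrite op_K //; apply: K1_good.
- by move=> M N; rewrite !inE => /K1_good gM /K1_good gN;
  apply: insertion_isomorphic.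
- move=> M'; rewrite inE => KM'; have [M [h [gM iM]]] := op_onto KM'.
  exists M; last by apply/isomorphicP; exists h.
  by rewrite inE -op_K // (K2_inv iM).
Qed.

End InsertionClasses.

(** * Every vertex of degree 2 or 3 arises by insertion *)

Section NormalForm.

Variables (D : finType) (M' : rmap (D + dart6)%type).
Local Notation n' := (node_of M').
Local Notation e' := (edge_of M').
Local Notation f' := (face_of M').

Hypothesis gM : good M'.
Hypothesis rM : root_of M' = inr dp.
Hypothesis eM : forall z, e' (inr z) = inr (rev6 z).

(** The given values and the order 3 of [f'] force the faces at all new darts, which is what
    [graft_surj] requires. *)
Lemma digon_normal r0 :
    n' (inr dp) = inr dq -> n' (inr dq) = inr dp -> f' (inr dq) = inr dw' ->
    f' (inr dp) = inl r0 ->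
  exists M : rmap D, good M /\ M' = insert_digon M.
Proof.
move=> np nq fq fp.
set tau := tperm (inl r0) (inr dw) : {perm (D + dart6)%type}.
have fE x : f' x = n' (e' x) by apply: faceE.
have fp' : f' (inr dp') = inr dq by rewrite fE eM np.
have fq' : f' (inr dq') = inr dp by rewrite fE eM nq.
have fw' : f' (inr dw') = inr dp' by rewrite -fq -[inr dp'](good_face gM) fp'.
have fr : f' (inl r0) = inr dq' by rewrite -fp -[inr dq'](good_face gM) fq'.
have [|M [rM0 M'_eq f_eq]] := graft_surj (rho := digon_rho) (tau := tau) r0 rM
  eM.
  move=> z; rewrite -[inr z](tpermK (inl r0) (inr dw)) -/tau tpermV permJ
    digon_rhoE.
  by case: z => [[[]|] []] /=;
    rewrite ?(tpermR, tpermL) ?(tpermD (z := inr _)) //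
    ?(fp, fp', fq, fq', fw', fr) ?(tpermR, tpermL) ?(tpermD (z := inr _)).
exists M; have M'E : M' = insert_digon M by rewrite M'_eq /tau -rM0.
split=> //; apply/insert_digon_good; last by rewrite -M'E.
(* The side condition of [insert_digon_good] is inherited: [tau] would carry a fixed point of the
   old face permutation to one of [f']. *)
rewrite rM0; apply/negP => /eqP fr0.
have : f' (tau (inl r0)) = tau (inl r0) by rewrite f_eq permJ perm_suml fr0.
by apply/eqP; apply: face_neq.
Qed.

Lemma star_normal r0 s0 t0 :
    n' (inr dp) = inr dw -> n' (inr dw) = inr dq -> n' (inr dq) = inr dp ->
    f' (inr dp) = inl r0 -> f' (inr dq) = inl s0 -> f' (inr dw) = inl t0 ->
  exists M : rmap D, good M /\ M' = insert_star M.
Proof.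
move=> np nw nq fp fq fw.
set tau := (tperm (inl s0) (inr dq') * tperm (inl t0) (inr dp))%g : {perm (D +
  dart6)%type}.
have fE x : f' x = n' (e' x) by apply: faceE.
have fp' : f' (inr dp') = inr dw by rewrite fE eM np.
have fq' : f' (inr dq') = inr dp by rewrite fE eM nq.
have fw' : f' (inr dw') = inr dq by rewrite fE eM nw.
have fr : f' (inl r0) = inr dq' by rewrite -fp -[inr dq'](good_face gM) fq'.
have fs : f' (inl s0) = inr dw' by rewrite -fq -[inr dw'](good_face gM) fw'.
have ft : f' (inl t0) = inr dp' by rewrite -fw -[inr dp'](good_face gM) fp'.
have sr : s0 != r0 by apply: contraTneq isT => E; move: fr; rewrite -E fs.
have st : s0 != t0 by apply: contraTneq isT => E; move: fs; rewrite E ft.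
have rt : r0 != t0 by apply: contraTneq isT => E; move: fr; rewrite E ft.
have inl_neq (x y : D) : x != y -> inl x != inl y :> D + dart6.
  by apply: contraNneq => -[->].
have tau_q' : tau (inr dq') = inl s0
  by rewrite permM tpermR tpermD // inl_neq // eq_sym.
have tau_p : tau (inr dp) = inl t0
  by rewrite permM (tpermD (z := inr dp)) // tpermR.
have tau_s : tau (inl s0) = inr dq' by rewrite permM tpermL tpermD.
have tau_t : tau (inl t0) = inr dp.
  by rewrite permM (tpermD (z := inl t0)) ?tpermL // inl_neq.
have tau_r : tau (inl r0) = inl r0.
  by rewrite permM !tpermD //; apply: inl_neq => //; rewrite eq_sym.
have tau_z z : z != dq' -> z != dp -> tau (inr z) = inr z.
  move=> zq zp; have inr_z y : z != y -> inr y != inr z :> D + dart6.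
    by apply: contraNneq => -[->].
  by rewrite permM !tpermD //; apply: inr_z.
have tau_inv x y : tau x = y -> (tau^-1)%g y = x by move=> <-; rewrite permK.
have [|M [rM0 M'_eq f_eq]] := graft_surj (rho := star_rho) (tau := tau) r0 rM
  eM.
  move=> z; rewrite star_rhoE -[inr z](permK tau) permJ.
  by apply: tau_inv; case: z => [[[]|] []] /=; rewrite ?tau_q' ?tau_p ?tau_z //
    ?(fp, fp', fq, fq', fw, fw', fr, fs, ft) ?tau_q' ?tau_p ?tau_z.
have fM a b : f' (tau (inl a)) = tau (inl b) -> face_of M a = b.
  by rewrite f_eq permJ perm_suml => /perm_inj[].
have fr0 : face_of M r0 = s0 by apply: fM; rewrite tau_r tau_s.
have fs0 : face_of M s0 = t0 by apply: fM; rewrite tau_s tau_t.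
exists M; have M'E : M' = insert_star M.
  by rewrite M'_eq /tau /insert_star rM0 fr0 fs0.
by split=> //; apply/insert_star_good; rewrite ?rM0 ?fr0 // -M'E.
Qed.

End NormalForm.

Lemma relabel_along (D D' : finType) (M' : rmap D') (w : dart6 -> D') :
  injective w -> #|D'| = #|D| + 6 ->
  exists (M : rmap (D + dart6)%type) h, is_iso h M M' /\ forall z,
    h (inr z) = w z.
Proof.
rewrite -card_dart6 => w_inj /(injection_extends w_inj)[h [g [hK gK hw]]].
by exists (relabel gK hK M'), h; split; first exact: relabel_isoV.
Qed.

Section Onto.

Variables (D D' : finType) (M' : rmap D').
Hypothesis cardD' : #|D'| = #|D| + 6.
Hypothesis gM : good M'.
Local Notation n := (node_of M').
Local Notation e := (edge_of M').
Local Notation f := (face_of M').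
Local Notation p := (root_of M').

Let vE x : porbit n (f x) = porbit n (e x) := face_edge_porbit M' x.
Let vn x : porbit n (n x) = porbit n x := porbit_image n x.

Section DigonOnto.

Hypothesis deg2 : degree M' p = 2.
(** Excludes the three-edge triangle, where the two faces at the root vertex share their third side
    and there is no digon to close. *)
Hypothesis third3 : 2 < degree M' (f (f p)).

(** The faces at the root vertex have third sides [f p] and [f (n p)], which bound the digon. The
    second is removed with the vertex; [f p] survives as the old root. *)
Definition digon_word (z : dart6) : D' :=
  match z with
  | (Some true, false) => p | (Some true, true) => e p
  | (Some false, false) => n p | (Some false, true) => e (n p)
  | (None, true) => f (n p) | (None, false) => e (f (n p))
  end.

Let eK := good_edge gM.
Let fE x : f x = n (e x) := faceE M' x.
Let nnp : n (n p) = p.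
Proof. by have := iter_porbit n p; rewrite -/(degree M' p) deg2. Qed.
Let fq' : f (e (n p)) = p. Proof. by rewrite fE eK. Qed.
Let ffp : f (f p) = e (n p). Proof. by rewrite -{1}fq' good_face. Qed.
Let fp' : f (e p) = n p. Proof. by rewrite fE eK. Qed.
Let fw' : f (f (n p)) = e p. Proof. by rewrite -fp' good_face. Qed.

Let UA : porbit n p != porbit n (e p).
Proof. by rewrite eq_sym (loop_neq gM). Qed.
Let UB : porbit n p != porbit n (e (n p)).
Proof. by rewrite eq_sym -(porbit_image n p) (loop_neq gM). Qed.
Let AB : porbit n (e p) != porbit n (e (n p)).
Proof. by rewrite -fw' -vE (face1_neq gM). Qed.

Let digon_word_vertex z : porbit n (digon_word z) =
  match z with
  | (Some true, false) | (Some false, false) => porbit n p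
  | (Some true, true) | (None, false) => porbit n (e p)
  | (Some false, true) | (None, true) => porbit n (e (n p))
  end.
Proof. by case: z => [[[]|] []] //=; rewrite -?vE ?vn // fw'. Qed.

Let np_neq : n p != p.
Proof.
apply/eqP => np; move: deg2; rewrite /degree.
by rewrite porbit2 ?np // setUid cards1.
Qed.

Let wp'_neq : e (f (n p)) != e p.
Proof.
rewrite (inj_eq perm_inj); apply: contraNneq UB => fnp.
by rewrite -vE fnp.
Qed.

Let w'q'_neq : f (n p) != e (n p).
Proof.
apply: contraNneq UA => E; rewrite -(vn p) -[n p]eK -E.
by rewrite -vE fw'.
Qed.

Lemma digon_word_inj : injective digon_word.
Proof.
move=> z1 z2 E; have := congr1 (porbit n) E; rewrite !digon_word_vertex.
case: z1 z2 E => [[[]|] []] [[[]|] []] //= E V;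
  try (by move: UA; rewrite V eqxx); try (by move: UB; rewrite V eqxx);
  try (by move: AB; rewrite V eqxx);
  try (by move: np_neq; rewrite -E eqxx); try (by move: np_neq; rewrite E eqxx);
  try (by move: wp'_neq; rewrite E eqxx);
  by move: w'q'_neq; rewrite E eqxx.
Qed.

Lemma digon_word_face z : f p != digon_word z.
Proof.
apply/eqP => E; have := congr1 (porbit n) E; rewrite vE digon_word_vertex.
case: z E => [[[]|] []] //= E V;
  try (by move: UA; rewrite V eqxx); try (by move: AB; rewrite V eqxx).
  by move: UB; rewrite -ffp E fp' vn eqxx.
(* Here both third sides are the same edge, so the far vertex of the digon carries only two
   darts. *)
have nw' : n (f (n p)) = e (n p) by rewrite -ffp E [RHS]fE eK.
have nq' : n (e (n p)) = f (n p) by rewrite fE.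
have: degree M' (f (n p)) <= 2 by rewrite /degree porbit2 ?nw' // cards2;
  case: eqP.
have -> : degree M' (f (n p)) = degree M' (f (f p)) by rewrite /degree ffp vE.
by rewrite leqNgt third3.
Qed.

(** The head of the root carries the root edge and both sides of the digon. With no further dart,
    these sides would share a face outside the digon, whose third side would be a loop. *)
Lemma degree_next_to_degree2 : 4 <= degree M' (e p).
Proof.
have n_ep : n (e p) = f p by rewrite fE.
have n_w : n (e (f (n p))) = e p by rewrite -fE fw'.
have ep_fp : e p != f p by rewrite eq_sym;
  apply: (digon_word_face (Some true, true)).
have w_fp : e (f (n p)) != f p.
  by rewrite eq_sym; apply: (digon_word_face (None, false)).
have nfp_w : n (f p) != e (f (n p)).
  apply: contraNneq (face2_neq gM (e (f p))) => E.
  by rewrite (vE (f _)) (fE (e (f p))) (eK (f p)) E eK -vE ffp vE.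
have nfp_ep : n (f p) != e p by rewrite -n_w (inj_eq perm_inj) eq_sym.
have nfp_fp : n (f p) != f p by rewrite -{2}n_ep (inj_eq perm_inj) eq_sym.
have U : uniq [:: e (f (n p)); e p; f p; n (f p)].
  rewrite /= !inE !negb_or wp'_neq w_fp ep_fp ![_ == n (f p)]eq_sym.
  by rewrite nfp_w nfp_ep nfp_fp.
have /= <- := card_uniqP U; apply: subset_leq_card; apply/subsetP => x.
rewrite !inE -eq_porbit_mem.
by case/or4P => /eqP->; rewrite ?vn ?vE // -n_w vn.
Qed.

Lemma insert_digon_onto :
  exists (M : rmap D) h, good M /\ is_iso h (insert_digon M) M'.
Proof.
have [M [h [iM hw]]] := relabel_along M' digon_word_inj cardD'.
have [h' iM'] := is_iso_sym iM; have gM2 := is_iso_good iM' gM.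
have h_inj := is_iso_inj iM.
have eM z : edge_of M (inr z) = inr (rev6 z).
  apply: h_inj; rewrite -(is_iso_edge iM) !hw.
  by case: z => [[[]|] []] //=; rewrite eK.
have rM : root_of M = inr dp by apply: h_inj; rewrite -(is_iso_root iM) hw.
have fM : exists r0, face_of M (inr dp) = inl r0.
  case fz: (face_of M _) => [r0|z]; first by exists r0.
  have := digon_word_face z; rewrite -hw -fz -(is_iso_face iM) hw.
  by rewrite eqxx.
have [r0 fp] := fM.
have [|||N [gN MN]] := digon_normal gM2 rM eM _ _ _ fp.
- by apply: h_inj; rewrite -(is_iso_node iM) !hw.
- by apply: h_inj; rewrite -(is_iso_node iM) !hw.
- by apply: h_inj; rewrite -(is_iso_face iM) !hw.
by exists N, h; rewrite -MN.
Qed.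

End DigonOnto.

Section StarOnto.

Hypothesis deg3 : degree M' p = 3.

Definition star_word (z : dart6) : D' :=
  let x := match z.1 with Some true => p | Some false => n (n p) | None =>
    n p end in
  if z.2 then e x else x.

Let eK := good_edge gM.
Let fE x : f x = n (e x) := faceE M' x.
Let nnnp : n (n (n p)) = p.
Proof. by have := iter_porbit n p; rewrite -/(degree M' p) deg3. Qed.

Let star_out i : porbit n (star_word (i, false)) = porbit n p.
Proof. by case: i => [[]|]; rewrite /star_word /= ?vn. Qed.

Let star_in i : star_word (i, true) = e (star_word (i, false)).
Proof. by case: i => [[]|]. Qed.

Lemma star_word_inj : injective star_word.
Proof.
have np : n p != p.
  apply/eqP => np; move: deg3; rewrite /degree.
  by rewrite porbit2 ?np // setUid cards1.
have nnp : n (n p) != p.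
  apply/eqP => nnp; move: deg3; rewrite /degree.
  by rewrite porbit2 // cards2; case: eqP.
have out_inj i j : star_word (i, false) = star_word (j, false) -> i = j.
  case: i j => [[]|] [[]|] //=; rewrite /star_word /= => E //.
  - by move: nnp; rewrite -E eqxx.
  - by move: np; rewrite -E eqxx.
  - by move: nnp; rewrite E eqxx.
  - by move: np; rewrite -(inj_eq (@perm_inj _ n)) E eqxx.
  - by move: np; rewrite E eqxx.
  - by move: np; rewrite -(inj_eq (@perm_inj _ n)) -E eqxx.
have out_in i j : star_word (i, false) <> e (star_word (j, false)).
  move=> E; have := loop_neq gM (star_word (j, false)).
  by rewrite -E !star_out eqxx.
move=> [i []] [j []]; rewrite ?star_in.
- by move/perm_inj/out_inj->.
- by move/esym/out_in.
- by move/out_in.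
- by move/out_inj->.
Qed.

(** The side opposite to the root vertex in a face avoids that vertex, whereas each dart of the star
    has it as an end. *)
Lemma star_word_face i z : f (star_word (i, false)) != star_word z.
Proof.
apply/eqP; case: z => j []; rewrite ?star_in => E.
  have := face2_neq gM (star_word (i, false)).
  by rewrite vE E eK !star_out eqxx.
by have := face1_neq gM (star_word (i, false)); rewrite E !star_out eqxx.
Qed.

Lemma insert_star_onto :
  exists (M : rmap D) h, good M /\ is_iso h (insert_star M) M'.
Proof.
have [M [h [iM hw]]] := relabel_along M' star_word_inj cardD'.
have [h' iM'] := is_iso_sym iM; have gM2 := is_iso_good iM' gM.
have h_inj := is_iso_inj iM.
have eM z : edge_of M (inr z) = inr (rev6 z).
  apply: h_inj; rewrite -(is_iso_edge iM) !hw.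
  by case: z => [i []]; rewrite /rev6 /= star_in ?eK.
have rM : root_of M = inr dp by apply: h_inj; rewrite -(is_iso_root iM) hw.
have fM i : exists r0, face_of M (inr (i, false)) = inl r0.
  case fz: (face_of M _) => [r0|z]; first by exists r0.
  have := star_word_face i z; rewrite -hw -hw -fz -(is_iso_face iM).
  by rewrite eqxx.
have [r0 fp] := fM (Some true); have [s0 fq] := fM (Some false).
have [t0 fw] := fM None.
have [|||N [gN MN]] := star_normal gM2 rM eM _ _ _ fp fq fw.
- by apply: h_inj; rewrite -(is_iso_node iM) !hw.
- by apply: h_inj; rewrite -(is_iso_node iM) !hw.
- by apply: h_inj; rewrite -(is_iso_node iM) !hw.
by exists N, h; rewrite -MN.
Qed.

End StarOnto.

End Onto.

(** * Degree conditions under insertion *)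

Definition root_degree (D : finType) (M : rmap D) : nat := degree M (root_of M).

Definition apex (D : finType) (M : rmap D) : D :=
  face_of M (face_of M (root_of M)).

Definition apex_degree (D : finType) (M : rmap D) : nat := degree M (apex M).

(* Deleting a vertex of degree 3 next to the root from a map of [bold_H] may  *)
(* leave a vertex of degree 3 at the apex of the new root face.               *)
Definition bold_F (D : finType) (M : rmap D) : bool :=
  [&& good_map M, 3 <= apex_degree M &
      [forall x, [|| x \in porbit (node_of M) (root_of M),
                     x \in porbit (node_of M) (edge_of M (root_of M)),
                     x \in porbit (node_of M) (apex M) | 4 <= degree M x]]].

Section ClassSpecs.

Variables (D : finType) (M : rmap D).
Local Notation n := (node_of M).
Local Notation e := (edge_of M).
Local Notation r := (root_of M).

Lemma bold_HP : reflect
  (good M /\ forall x, x \notin porbit n r -> x \notin porbit n (e r) ->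
    4 <= degree M x)
  (bold_H M).
Proof.
rewrite /bold_H andbA;
  apply: (iffP andP) => [[/goodP gM /forall_inP dM]|[gM dM]].
  split=> // x xr xer; apply: (implyP (dM _ (mem_vertices M x))).
  by rewrite /incident_to_root !eq_porbit_mem negb_or xr.
split; first exact/goodP.
apply/forall_inP => _ /imsetP[x _ ->]; apply/implyP.
by rewrite /incident_to_root !eq_porbit_mem negb_or => /andP[]; apply: dM.
Qed.

Lemma bold_HstarE :
  bold_Hstar M = [&& bold_H M, 4 <= root_degree M & 4 <= root_degree (flip M)].
Proof.
apply/idP/and3P => [|[/bold_HP[gM dM] dr der]].
  rewrite /bold_Hstar andbA => /andP[/goodP gM /forall_inP dM].
  have d4 x : 4 <= degree M x by apply: dM; apply: mem_vertices.
  by split; [apply/bold_HP | apply: d4 | apply: d4].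
rewrite /bold_Hstar andbA; apply/andP; split; first exact/goodP.
apply/forall_inP => _ /imsetP[x _ ->]; rewrite -/(degree M x).
have [xr|xr] := boolP (x \in porbit n r); first by rewrite (degree_porbit xr).
have [xer|xer] := boolP (x \in porbit n (e r));
  first by rewrite (degree_porbit xer).
exact: dM.
Qed.

Lemma bold_FP : reflect
  [/\ good M, 3 <= apex_degree M & forall x, x \notin porbit n r ->
      x \notin porbit n (e r) -> x \notin porbit n (apex M) -> 4 <= degree M x]
  (bold_F M).
Proof.
apply: (iffP and3P) => [[/goodP gM aM /forallP dM]|[gM aM dM]].
  split=> // x xr xer xa; have := dM x.
  by rewrite (negPf xr) (negPf xer) (negPf xa).
split=> //; first exact/goodP; apply/forallP => x.
case: (boolP (x \in porbit n r)) => //= xr;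
  case: (boolP (x \in porbit n (e r))) => //= xer.
by case: (boolP (x \in porbit n (apex M))) => //= xa; apply: dM.
Qed.

Lemma bold_H_good : bold_H M -> good M.
Proof. by case/bold_HP. Qed.

Lemma bold_F_good : bold_F M -> good M.
Proof. by case/bold_FP. Qed.

Hypothesis gM : good M.

Lemma apex_notin_root : apex M \notin porbit n r.
Proof. by rewrite -eq_porbit_mem face2_neq. Qed.

Lemma apex_notin_head : apex M \notin porbit n (e r).
Proof. by rewrite -eq_porbit_mem -face_edge_porbit face1_neq. Qed.

Lemma bold_F_apex : bold_F M && (apex_degree M != 3) = bold_H M.
Proof.
apply/andP/bold_HP => [[/bold_FP[_ aM dM] a3]|[_ dM]].
  split=> // x xr xer; have [xa|xa] := boolP (x \in porbit n (apex M));
    last exact: dM.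
  by rewrite (degree_porbit xa) ltn_neqAle eq_sym a3.
have a4 : 4 <= apex_degree M by apply: dM;
  [apply: apex_notin_root | apply: apex_notin_head].
split; last by apply: contraTneq a4 => ->.
by apply/bold_FP; split=> //; [apply: ltnW | move=> x xr xer _; apply: dM].
Qed.

End ClassSpecs.

Section Invariance.

Variables (D1 D2 : finType) (h : D1 -> D2) (M : rmap D1) (N : rmap D2).
Hypothesis iMN : is_iso h M N.

Lemma is_iso_apex : apex N = h (apex M).
Proof. by rewrite /apex (is_iso_root iMN) !(is_iso_face iMN). Qed.

Lemma is_iso_root_degree : root_degree N = root_degree M.
Proof. by rewrite /root_degree (is_iso_root iMN) (is_iso_degree iMN). Qed.

Lemma is_iso_apex_degree : apex_degree N = apex_degree M.
Proof. by rewrite /apex_degree is_iso_apex (is_iso_degree iMN). Qed.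

End Invariance.

Lemma bold_H_iso : iso_invariant bold_H.
Proof.
suff imp D1 D2 h (M : rmap D1) (N : rmap D2) : is_iso h M N -> bold_H M ->
  bold_H N.
  move=> D1 D2 h M N iMN; have [g iNM] := is_iso_sym iMN.
  by apply/idP/idP; [apply: (imp _ _ _ _ _ iMN) | apply: (imp _ _ _ _ _ iNM)].
move=> iMN /bold_HP[gM dM]; apply/bold_HP; split;
  first exact: is_iso_good iMN gM.
move=> y; have [x ->] := is_iso_onto iMN y.
rewrite (is_iso_root iMN) (is_iso_edge iMN) !(is_iso_mem iMN) (is_iso_degree
  iMN).
exact: dM.
Qed.

Lemma bold_F_iso : iso_invariant bold_F.
Proof.
suff imp D1 D2 h (M : rmap D1) (N : rmap D2) : is_iso h M N -> bold_F M ->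
  bold_F N.
  move=> D1 D2 h M N iMN; have [g iNM] := is_iso_sym iMN.
  by apply/idP/idP; [apply: (imp _ _ _ _ _ iMN) | apply: (imp _ _ _ _ _ iNM)].
move=> iMN /bold_FP[gM aM dM]; apply/bold_FP; split;
  first exact: is_iso_good iMN gM.
  by rewrite (is_iso_apex_degree iMN).
move=> y; have [x ->] := is_iso_onto iMN y.
rewrite (is_iso_apex iMN) (is_iso_root iMN) (is_iso_edge iMN) !(is_iso_mem iMN).
rewrite (is_iso_degree iMN); exact: dM.
Qed.

Section DigonDegrees.

Variables (D : finType) (M : rmap D).
Hypothesis gM : good M.
Local Notation n := (node_of M).
Local Notation e := (edge_of M).
Local Notation f := (face_of M).
Local Notation r := (root_of M).
Local Notation M' := (insert_digon M).

Let fr := face_neq gM r.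
Let good_M' : good M' := (insert_digon_good fr).2 gM.
Let mem := attached_mem (digon_attached fr (good_edge gM)).

Lemma digon_degree x :
  degree M' x = if old_dart (digon_att M) x is Some a then
                  degree M a + (r \in porbit n a).*2 + (e r \in porbit n a).*2
                else 2.
Proof.
rewrite /degree (card_porbit_attached (digon_attached fr (good_edge gM)))
  sum_dart6.
rewrite /same_vertex /=; case: (old_dart _ x) => [a|] //=; lia.
Qed.

Lemma digon_root_degree : root_degree M' = 2.
Proof. by rewrite /root_degree digon_degree. Qed.

Lemma digon_root_edge : edge_of M' (root_of M') = inr dp'.
Proof. exact: graft_edger. Qed.

Lemma digon_apex : apex M' = inr dq'.
Proof. by rewrite /apex (digon_face_new fr) (digon_face_root M). Qed.

Lemma digon_flip_apex : apex (flip M') = inr dw'.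
Proof.
rewrite /apex [root_of _]digon_root_edge.
have fE := digon_face_new fr; rewrite -[face_of _]/(face_of M') !fE.
by [].
Qed.

Lemma digon_head_degree z :
  digon_att M z = Some (e r) -> 4 <= degree M' (inr z).
Proof.
move=> /= attz; rewrite digon_degree /= attz porbit_id.
have := degree_ge2 gM (e r); lia.
Qed.

(* Only the degrees of the two ends of the old root edge change, so that in   *)
(* the new map they may be ignored: one is next to the root, the other has    *)
(* degree at least 4.                                                         *)
Lemma digon_degrees (S : pred (D + dart6)) :
    (forall x, x \in porbit (node_of M') (inr dp) -> S x) ->
    (forall x, x \in porbit (node_of M') (inr dp') -> S x) ->
    (forall x, S x -> x \notin porbit (node_of M') (inr dp) ->
       x \notin porbit (node_of M') (inr dp') ->
       x \in porbit (node_of M') (inr dq')) ->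
  (forall x, ~~ S x -> 4 <= degree M' x) <->
  (forall x, x \notin porbit n r -> x \notin porbit n (e r) -> 4 <= degree M x).
Proof.
move=> Su Sv Sb; split=> dM x.
  move=> xr xer; have := dM (inl x); rewrite digon_degree /=.
  rewrite porbit_sym (negPf xr) porbit_sym (negPf xer) !addn0; apply.
  apply/negP => /Sb; rewrite !mem /same_vertex /=.
  by rewrite (negPf xr) (negPf xer) => /(_ isT isT).
move=> Sx; have xu : x \notin porbit (node_of M') (inr dp)
  by apply: contra Sx => /Su.
have xv : x \notin porbit (node_of M') (inr dp') by apply: contra Sx => /Sv.
move: xu xv; rewrite digon_degree !mem /same_vertex /=.
case: (old_dart _ x) => [a|] // _ ar.
have [aer|aer] := boolP (a \in porbit n (e r)).
  rewrite [e r \in _]porbit_sym aer; have := degree_ge2 gM a; lia.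
by have := dM a ar aer; lia.
Qed.

Lemma bold_H_digon : bold_H M' = bold_H M.
Proof.
have dE := @digon_degrees [pred x | (x \in porbit (node_of M') (inr dp))
  || (x \in porbit (node_of M') (inr dp'))].
apply/bold_HP/bold_HP => -[_ dM]; split=> //.
  apply/dE => /= [x ->|x ->|x|x] //; first by rewrite orbT.
    by case/orP=> ->.
  by rewrite negb_or => /andP[xr xer]; apply: dM; rewrite ?digon_root_edge.
move=> x xr; rewrite digon_root_edge => xer;
  apply: (dE _ _ _).2 => //= [y ->|y ->|y|] //.
- by rewrite orbT.
- by case/orP=> ->.
- by rewrite negb_or xr.
Qed.

Let bold_F_digon_aux z (zb : digon_att M z = Some (e r)) :
  (forall x, x \notin porbit (node_of M') (inr dp) ->
    x \notin porbit (node_of M') (inr dp') ->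
    x \notin porbit (node_of M') (inr z) -> 4 <= degree M' x) <->
  (forall x, x \notin porbit n r -> x \notin porbit n (e r) -> 4 <= degree M x).
Proof.
have zq' : porbit (node_of M') (inr z) = porbit (node_of M') (inr dq').
  by apply/eqP; rewrite eq_porbit_mem mem /same_vertex /= zb porbit_id.
rewrite zq' -(@digon_degrees [pred x | [|| x \in porbit (node_of M') (inr dp),
  x \in porbit (node_of M') (inr dp') | x \in porbit (node_of M') (inr dq')]]).
- split=> dM x; first by rewrite !negb_or => /and3P[]; apply: dM.
  by move=> xu xv xb; apply: dM; rewrite /= !negb_or xu xv.
- by move=> x /= ->.
- by move=> x /= ->; rewrite orbT.
- by move=> x /= + /negPf xu /negPf xv; rewrite xu xv.
Qed.

(** The apex is the far end of the digon, of degree at least 4 by [digon_head_degree], so the weaker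
    condition of [bold_F] at the apex gains nothing. *)
Lemma bold_F_digon : bold_F M' = bold_H M.
Proof.
have dE := @bold_F_digon_aux dq' erefl.
apply/bold_FP/bold_HP; rewrite digon_root_edge digon_apex.
  by case=> _ _ /dE.
case=> _ /dE dM; split=> //; rewrite /apex_degree digon_apex.
exact/ltnW/digon_head_degree.
Qed.

Lemma bold_F_flip_digon : bold_F (flip M') = bold_H M.
Proof.
have dE := @bold_F_digon_aux dw' erefl.
have gF : good (flip M') by apply: reroot_good.
have rE : root_of (flip M') = inr dp' := digon_root_edge.
have erE : edge_of (flip M') (root_of (flip M')) = inr dp
  by apply: (good_edge good_M').
apply/bold_FP/bold_HP; rewrite erE digon_flip_apex rE.
  by case=> _ _ dM; split=> //; apply/dE => x xu xv; apply: dM.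
case=> _ /dE dM; split=> //; last by move=> x xv xu; apply: dM.
by rewrite /apex_degree digon_flip_apex; apply/ltnW/digon_head_degree.
Qed.

End DigonDegrees.

Section StarDegrees.

Variables (D : finType) (M : rmap D).
Hypothesis gM : good M.
Local Notation n := (node_of M).
Local Notation e := (edge_of M).
Local Notation f := (face_of M).
Local Notation r := (root_of M).
Local Notation M' := (insert_star M).

Let fr := face_neq gM r.
Let good_M' : good M' := (insert_star_good fr).2 gM.
Let attM := star_attached fr (good_face gM) (good_edge gM).
Let mem := attached_mem attM.

Lemma star_degree x :
  degree M' x = if old_dart (star_att M) x is Some a then
                  degree M a + (a \in porbit n r) + (a \in porbit n (e r))
                    + (a \in porbit n (apex M))
                else 3.
Proof.
rewrite /degree (card_porbit_attached attM) sum_dart6 /same_vertex /=.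
case: (old_dart _ x) => [a|] //=.
by rewrite -face_edge_porbit !(porbit_sym n a) /apex; lia.
Qed.

Lemma star_root_degree : root_degree M' = 3.
Proof. by rewrite /root_degree star_degree. Qed.

Lemma star_root_edge : edge_of M' (root_of M') = inr dp'.
Proof. exact: graft_edger. Qed.

Lemma star_flip_root_degree : root_degree (flip M') = (root_degree M).+1.
Proof.
have rE : root_of (flip M') = inr dp' := star_root_edge.
rewrite /root_degree rE [degree (flip M') _]star_degree /= porbit_id.
rewrite -!eq_porbit_mem [_ == porbit n (e r)]eq_sym (negPf (loop_neq gM r)).
by rewrite [_ == porbit n (apex M)]eq_sym (negPf (face2_neq gM r)) !addn0 addn1.
Qed.

Lemma star_turn_root : root_of (turn M') = inl r.
Proof. exact: (star_face_new fr (good_face gM) dp). Qed.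

Lemma star_turn_apex : apex (turn M') = inr dp.
Proof. exact: (good_face good_M'). Qed.

(** The insertion raises by one the degrees of the corners of the root face. The old root origin
    stays on the root edge, hence unconstrained; the old head and the apex must reach 4, so they
    need 3 beforehand. *)
Lemma bold_H_star : bold_H M' = bold_F M && (3 <= root_degree (flip M)).
Proof.
have aDr := apex_notin_root gM; have aDer := apex_notin_head gM.
have erDr := good_loop gM r.
have aDer' : e r \notin porbit n (apex M) by rewrite porbit_sym.
apply/bold_HP/andP; rewrite ?star_root_edge.
  case=> _ dM; have dM' a : a \notin porbit n r -> 4 <= degree M' (inl a).
    by move=> ar; apply: dM; rewrite mem /same_vertex.
  split; [apply/bold_FP; split=> // | ].
  - have := dM' _ aDr; rewrite star_degree /= (negPf aDr) (negPf aDer)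
    porbit_id.
    by rewrite !addn0 addn1.
  - move=> a ar aer aa; have := dM' a ar; rewrite star_degree /=.
    by rewrite (negPf ar) (negPf aer) (negPf aa) !addn0.
  - have := dM' _ erDr;
    rewrite star_degree /= (negPf erDr) (negPf aDer') porbit_id.
    by rewrite !addn0 addn1.
case=> /bold_FP[_ a3 dM] er3; split=> // x;
  rewrite !mem star_degree /same_vertex /=.
case: (old_dart _ x) => [a|] // _ ar; rewrite (negPf ar) addn0.
have [aer|aer] := boolP (a \in porbit n (e r)).
  have : 3 <= degree M a by rewrite (degree_porbit aer).
  by lia.
have [aa|aa] := boolP (a \in porbit n (apex M)).
  have : 3 <= degree M a by rewrite (degree_porbit aa).
  by lia.
by rewrite !addn0; apply: dM.
Qed.

(** Rotating the root of [M'] puts it back on the old root edge, with the new vertex of degree 3 as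
    apex. Only the old apex needs its extra dart to reach degree 4. *)
Lemma bold_F_turn_star : bold_F (turn M') = bold_F M.
Proof.
have aDr := apex_notin_root gM; have aDer := apex_notin_head gM.
have gT : good (turn M') by apply: reroot_good.
have erE : edge_of (turn M') (inl r) = inl (e r) by apply: graft_edgel.
apply/bold_FP/bold_FP; rewrite star_turn_root erE star_turn_apex.
  case=> _ _ dM.
  have dM' a : a \notin porbit n r -> a \notin porbit n (e r) ->
    4 <= degree M' (inl a).
    by move=> ar aer; apply: dM; rewrite [_ \in _]mem.
  split=> //.
    have := dM' _ aDr aDer;
      rewrite star_degree /= (negPf aDr) (negPf aDer) porbit_id.
    by rewrite !addn0 addn1.
  move=> a ar aer aa; have := dM' a ar aer; rewrite star_degree /=.
  by rewrite (negPf ar) (negPf aer) (negPf aa) !addn0.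
case=> _ a3 dM; split=> //.
  by rewrite /apex_degree star_turn_apex [degree _ _]star_degree.
move=> x; rewrite ![x \in _]mem [degree _ _]star_degree /same_vertex /=.
case: (old_dart _ x) => [a|] // ar aer _; rewrite (negPf ar) (negPf aer) !addn0.
have [aa|aa] := boolP (a \in porbit n (apex M)).
  have : 3 <= degree M a by rewrite (degree_porbit aa).
  by lia.
by rewrite addn0; apply: dM.
Qed.

End StarDegrees.

(** * Relations between the counting sequences *)

Section Insertions.

Variables (D D' : finType) (K1 K2 : map_class).
Hypothesis cardD' : #|D'| = #|D| + 6.
Hypothesis K2_iso : iso_invariant K2.
Hypothesis K1_good : forall M : rmap D, K1 M -> good M.

Let card_sum6 : #|{: D + dart6}| = #|D| + 6.
Proof. by rewrite card_sum card_dart6. Qed.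

Lemma iso_classes_digon :
    (forall M : rmap D, good M -> K2 (insert_digon M) = K1 M) ->
    (forall M : rmap (D + dart6)%type, K2 M ->
       [/\ good M, root_degree M = 2 & 3 <= apex_degree M]) ->
  iso_classes K2 D' = iso_classes K1 D.
Proof.
move=> opK K2_deg; apply: (iso_classes_insertion (op := @insert_digon D)) => //.
- exact: insert_digon_act.
- exact: insert_digon_inj.
- exact: insert_digon_rigid.
- by move=> M' /K2_deg[gM d2 a3]; apply: insert_digon_onto.
Qed.

Lemma iso_classes_star :
    (forall M : rmap D, good M -> K2 (insert_star M) = K1 M) ->
    (forall M : rmap (D + dart6)%type, K2 M -> good M /\ root_degree M = 3) ->
  iso_classes K2 D' = iso_classes K1 D.
Proof.
move=> opK K2_deg; apply: (iso_classes_insertion (op := @insert_star D)) => //.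
- exact: insert_star_act.
- exact: insert_star_inj.
- exact: insert_star_rigid.
- by move=> M' /K2_deg[gM d3]; apply: insert_star_onto.
Qed.

End Insertions.

Lemma bold_H_apex_degree (D : finType) (M : rmap D) :
  bold_H M -> 4 <= apex_degree M.
Proof.
case/bold_HP=> gM dM; apply: dM; first exact: apex_notin_root.
exact: apex_notin_head.
Qed.

Lemma root_degree_ge2 (D : finType) (M : rmap D) : good M -> 2 <= root_degree M.
Proof. by move=> gM; apply: degree_ge2. Qed.

Lemma head_degree_ge4 (D : finType) (M : rmap D) : good M ->
  root_degree M = 2 -> 3 <= apex_degree M -> 4 <= root_degree (flip M).
Proof. by move=> gM d2 a3; apply: (degree_next_to_degree2 gM). Qed.

Lemma bold_H_flip (D : finType) (M : rmap D) :
  good M -> bold_H (flip M) = bold_H M.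
Proof.
suff imp (N : rmap D) : bold_H N -> bold_H (flip N).
  move=> gM; apply/idP/idP; last exact: imp.
  by move/imp; rewrite flipK.
case/bold_HP=> gN dN; apply/bold_HP; split; first exact: reroot_good.
move=> x xr xer; apply: dN => //.
by move: xer; rewrite [edge_of _ _](good_edge gN).
Qed.

(* A vertex of degree 2 at the root origin lies in a digon, whose other end   *)
(* is the apex of both root faces.                                            *)
Lemma flip_apex_degree (D : finType) (M : rmap D) : good M ->
  root_degree M = 2 -> apex_degree (flip M) = apex_degree M.
Proof.
move=> gM d2; set r := root_of M.
have nn : node_of M (node_of M r) = r.
  by have := iter_porbit (node_of M) r;
    rewrite -/(degree M r) -/(root_degree M) d2.
have fer : face_of M (edge_of M r) = node_of M r by rewrite faceE good_edge.
have apexM : apex M = edge_of M (node_of M r).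
  rewrite -[RHS](good_face gM); congr (face_of M (face_of M _)).
  by rewrite faceE good_edge // nn.
rewrite /apex_degree /degree apexM -[apex _]/(face_of M (face_of M (edge_of M
  r))).
by rewrite fer -face_edge_porbit.
Qed.

Definition H_origin2 (D : finType) (M : rmap D) : bool :=
  bold_H M && (root_degree M == 2).
Definition H_origin3 (D : finType) (M : rmap D) : bool :=
  bold_H M && (root_degree M == 3).
Definition H_ends3 (D : finType) (M : rmap D) : bool :=
  [&& bold_H M, root_degree M == 3 & root_degree (flip M) == 3].
Definition F_origin2 (D : finType) (M : rmap D) : bool :=
  bold_F M && (root_degree M == 2).
Definition F_head2 (D : finType) (M : rmap D) : bool :=
  bold_F M && (root_degree (flip M) == 2).
Definition F_head_ge3 (D : finType) (M : rmap D) : bool :=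
  bold_F M && (3 <= root_degree (flip M)).
Definition F_apex3 (D : finType) (M : rmap D) : bool :=
  bold_F M && (apex_degree M == 3).

Section Relations.

Local Notation count K m := (iso_classes K 'I_(2 * (3 * m))).

Let card_size m : #|'I_(2 * (3 * m.+1))| = #|'I_(2 * (3 * m))| + 6.
Proof. by rewrite !card_ord; lia. Qed.

Lemma count_0 K : count K 0 = 0.
Proof. by apply: iso_classes_empty; rewrite card_ord. Qed.

Lemma count_H2 m : count H_origin2 m.+1 = count bold_H m.
Proof.
apply: (iso_classes_digon (card_size m)) => // [D1 D2 h M N iMN|M|M gM|M].
- by rewrite /H_origin2 (bold_H_iso iMN) (is_iso_root_degree iMN).
- exact: bold_H_good.
- by rewrite /H_origin2 bold_H_digon // digon_root_degree // eqxx andbT.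
- case/andP=> HM /eqP d2; split=> //; first exact: bold_H_good HM.
  exact/ltnW/bold_H_apex_degree.
Qed.

Lemma count_F2 m : count F_origin2 m.+1 = count bold_H m.
Proof.
apply: (iso_classes_digon (card_size m)) => // [D1 D2 h M N iMN|M|M gM|M].
- by rewrite /F_origin2 (bold_F_iso iMN) (is_iso_root_degree iMN).
- exact: bold_H_good.
- by rewrite /F_origin2 bold_F_digon // digon_root_degree // eqxx andbT.
- by case/andP=> /bold_FP[gM a3 _] /eqP d2.
Qed.

Lemma count_F_head2 m : count F_head2 m.+1 = count bold_H m.
Proof.
rewrite -(iso_classes_flip (K := F_head2)); last first.
  by move=> M /andP[/bold_F_good gM _]; apply/goodP.
rewrite /F_head2.
apply: (iso_classes_digon (card_size m)) => // [D1 D2 h M N iMN|M|M gM|M].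
- have iF := is_iso_flip iMN.
  by rewrite (bold_F_iso iF) (is_iso_root_degree (is_iso_flip iF)).
- exact: bold_H_good.
- rewrite bold_F_flip_digon // flipK; last exact/insert_digon_good/gM/face_neq.
  by rewrite digon_root_degree // eqxx andbT.
- case/andP=> /bold_FP[gF a3 _]; have gM : good M.
    by apply/goodP; rewrite -(reroot_goodE M (edge_of M (root_of M)));
      apply/goodP.
  by rewrite flipK // => /eqP d2; split=> //; rewrite -flip_apex_degree.
Qed.

Lemma count_H3 m : count H_origin3 m.+1 = count F_head_ge3 m.
Proof.
apply: (iso_classes_star (card_size m)) => // [D1 D2 h M N iMN|M|M gM|M].
- by rewrite /H_origin3 (bold_H_iso iMN) (is_iso_root_degree iMN).
- by case/andP=> /bold_F_good.
- by rewrite /H_origin3 bold_H_star // star_root_degree // andbT.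
- by case/andP=> /bold_H_good gM /eqP.
Qed.

(** Deleting one end lowers the degree of the other from 3 to 2; the condition of [bold_H_star] on
    the old head then holds by [head_degree_ge4]. *)
Lemma count_H33 m : count H_ends3 m.+1 = count F_origin2 m.
Proof.
apply: (iso_classes_star (card_size m)) => // [D1 D2 h M N iMN|M|M gM|M].
- rewrite /H_ends3 (bold_H_iso iMN) (is_iso_root_degree iMN).
  by rewrite (is_iso_root_degree (is_iso_flip iMN)).
- by case/andP=> /bold_F_good.
- rewrite /H_ends3 /F_origin2 bold_H_star // star_root_degree //
  star_flip_root_degree //=.
  rewrite eqSS; apply/andP/andP => [[/andP[-> _] ->] //|[FM d2]].
  by case/bold_FP: (FM) => _ a3 _;
    rewrite FM ltnW // head_degree_ge4 // (eqP d2).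
- by case/and3P=> /bold_H_good gM /eqP.
Qed.

(** Rotating the root in its face brings the apex to the root origin, where the star insertion
    applies. *)
Lemma count_F_apex3 m : count F_apex3 m.+1 = count bold_F m.
Proof.
rewrite -(iso_classes_turn (K := F_apex3)); last first.
  by move=> M /andP[/bold_F_good gM _]; apply/goodP.
have turn_apex D (M : rmap D) : good M -> apex_degree (turn M) = root_degree M.
  by move=> gM; rewrite /apex_degree /apex [face_of _ _](good_face gM).
have turn_good D (M : rmap D) : bold_F (turn M) -> good M.
  by move/bold_F_good/goodP; rewrite reroot_goodE => /goodP.
have -> : iso_classes (fun D M => F_apex3 (turn M)) 'I_(2 * (3 * m.+1)) =
          iso_classes (fun D M =>
            bold_F (turn M) && (root_degree M == 3)) 'I_(2 * (3 * m.+1)).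
  apply: iso_classes_eq => M; rewrite /F_apex3.
  by case FM: (bold_F (turn M)) => //=; rewrite turn_apex //; apply: turn_good.
apply: (iso_classes_star (card_size m)) => // [D1 D2 h M N iMN|M|M gM|M].
- by rewrite (bold_F_iso (is_iso_turn iMN)) (is_iso_root_degree iMN).
- exact: bold_F_good.
- by rewrite bold_F_turn_star // star_root_degree // andbT.
- by case/andP=> /turn_good gM /eqP.
Qed.

Lemma count_F m : count bold_F m.+1 = count bold_H m.+1 + count bold_F m.
Proof.
rewrite (@iso_classesID _ (fun D M => apex_degree M == 3)); last first.
  by move=> D1 D2 h M N iMN; rewrite (is_iso_apex_degree iMN).
rewrite -count_F_apex3 addnC; congr (_ + _); apply: iso_classes_eq => M.
case FM: (bold_F M) => /=; first by rewrite -(bold_F_apex (bold_F_good FM)) FM.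
symmetry; apply: contraFF FM => HM; have gM := bold_H_good HM.
by move: HM; rewrite -bold_F_apex // => /andP[].
Qed.

Lemma count_F_split m : count bold_F m = count F_head2 m + count F_head_ge3 m.
Proof.
rewrite (@iso_classesID _ (fun D M => root_degree (flip M) == 2)); last first.
  by move=> D1 D2 h M N iMN; rewrite (is_iso_root_degree (is_iso_flip iMN)).
congr (_ + _); apply: iso_classes_eq => M; rewrite /F_head_ge3.
case FM: (bold_F M) => //=; have gM := bold_F_good FM.
by rewrite [RHS]ltn_neqAle eq_sym root_degree_ge2 ?andbT //; apply: reroot_good.
Qed.

(** Inclusion-exclusion over the two ends, interchanged by [flip]. Degree 2 at one end excludes
    degree 2 or 3 at the other, so only [H_ends3] is counted twice; it stands on the left to avoid
    subtraction in [nat]. *)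
Lemma count_H_split m :
  count bold_H m + count H_ends3 m =
    count bold_Hstar m + 2 * count H_origin2 m + 2 * count H_origin3 m.
Proof.
have deg_iso k : iso_invariant (fun D M => root_degree M == k).
  by move=> D1 D2 h M N iMN; rewrite (is_iso_root_degree iMN).
have flip_iso k : iso_invariant (fun D M => root_degree (flip M) == k).
  by move=> D1 D2 h M N iMN; rewrite (is_iso_root_degree (is_iso_flip iMN)).
have by_head k : count (fun D M => bold_H M && (root_degree (flip M) == k)) m =
                 count (fun D M => bold_H M && (root_degree M == k)) m.
  rewrite -[RHS]iso_classes_flip; last by move=> M /andP[/bold_H_good /goodP].
  apply: iso_classes_eq => M /=.
  have [/goodP gM|ngM] := boolP (good_map M); first by rewrite bold_H_flip.
  have /negPf-> : ~~ bold_H M by apply: contra ngM => /bold_H_good /goodP.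
  suff /negPf-> : ~~ bold_H (flip M) by [].
  by apply: contra ngM => /bold_H_good /goodP; rewrite reroot_goodE.
have tail4 D (M : rmap D) : bold_H M -> root_degree M = 2 ->
  4 <= root_degree (flip M).
  by move=> HM d2; apply: head_degree_ge4 (bold_H_good HM) d2 (ltnW
    (bold_H_apex_degree HM)).
have head4 D (M : rmap D) : bold_H M -> root_degree (flip M) = 2 ->
  4 <= root_degree M.
  move=> HM d2; have gM := bold_H_good HM.
  by rewrite -{1}(flipK gM) tail4 // bold_H_flip.
have d2 D (M : rmap D) : bold_H M -> 2 <= root_degree M.
  by move/bold_H_good/root_degree_ge2.
have d2' D (M : rmap D) : bold_H M -> 2 <= root_degree (flip M).
  by move/bold_H_good => gM; apply/root_degree_ge2/reroot_good.
(* Peel off degrees 2 and 3 at the origin, then at the head; what remains is [bold_Hstar]. The last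
   splitting isolates, among heads of degree 3, the maps already removed with the origin. *)
have := iso_classesID bold_H 'I_(2 * (3 * m)) (deg_iso 2).
have := iso_classesID (fun D M =>
  bold_H M && (root_degree M != 2)) 'I_(2 * (3 * m)) (deg_iso 3).
set X2 := fun D M => _ && (root_degree M != 3).
have := iso_classesID X2 'I_(2 * (3 * m)) (flip_iso 2).
have := iso_classesID (fun D M =>
  X2 D M && (root_degree (flip M) != 2)) 'I_(2 * (3 * m)) (flip_iso 3).
have := iso_classesID (fun D M =>
  bold_H M && (root_degree (flip M) == 3)) 'I_(2 * (3 * m)) (deg_iso 3).
rewrite (by_head 3).
have E1 : count (fun D M =>
  bold_H M && (root_degree M != 2) && (root_degree M == 3)) m =
  count H_origin3 m.
  apply: iso_classes_eq => M; rewrite /H_origin3; case: (bold_H M) => //=.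
  by case: eqP => [->|].
have E2 : count (fun D M =>
  X2 D M && (root_degree (flip M) == 2)) m = count H_origin2 m.
  rewrite -[RHS](by_head 2); apply: iso_classes_eq => M; rewrite /X2.
  case HM: (bold_H M) => //=.
  case: (root_degree (flip M) =P 2) => [E|]; last by rewrite andbF.
  by have := head4 _ _ HM E; case: (root_degree M) => [|[|[|[|]]]].
have E3 : count (fun D M =>
  X2 D M && (root_degree (flip M) != 2) && (root_degree (flip M) == 3)) m =
   count (fun D M => bold_H M && (root_degree (flip M) == 3) &&
     (root_degree M != 3)) m.
  apply: iso_classes_eq => M; rewrite /X2.
  case HM: (bold_H M) => //=; case: (root_degree (flip M) =P 3) => [E|];
    last by rewrite !andbF.
  rewrite E /= !andbT; case: eqP => // E'.
  by have := tail4 _ _ HM E'; rewrite E.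
have E4 : count (fun D M =>
  bold_H M && (root_degree (flip M) == 3) && (root_degree M == 3)) m =
   count H_ends3 m.
  apply: iso_classes_eq => M; rewrite /H_ends3.
  by rewrite -andbA [_ && (root_degree M == 3)]andbC.
have E5 : count (fun D M =>
  X2 D M && (root_degree (flip M) != 2) && (root_degree (flip M) != 3)) m
   = count bold_Hstar m.
  apply: iso_classes_eq => M; rewrite /X2 bold_HstarE.
  case HM: (bold_H M) => //=; have := d2 _ _ HM; have := d2' _ _ HM.
  by case: (root_degree M) (root_degree (flip M)) =>
    [|[|[|[|a]]]] [|[|[|[|b]]]].
rewrite E1 E2 E3 E4 E5 => -> -> -> -> ->; rewrite -/H_origin2 -/H_origin3; lia.
Qed.

End Relations.

Import GRing.Theory.

Section Counting.

Local Notation hstar m := (iso_classes bold_Hstar 'I_(2 * (3 * m))).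
Local Notation h m := (iso_classes bold_H 'I_(2 * (3 * m))).

Lemma count_Hstar_0 : hstar 0 = 0.
Proof. exact: count_0. Qed.

Lemma count_H_0 : h 0 = 0.
Proof. exact: count_0. Qed.

(** The coefficient of t^(m+1) in (1 - t) H* = (1 - 5t + 5t^2 - 3t^3) H, with negative terms moved
    across; the value 0 stands for coefficients of negative index. *)
Lemma count_Hstar_S m :
  hstar m.+1 + 5 * h m + 3 * (if m is k.+2 then h k else 0) =
  hstar m + h m.+1 + 5 * (if m is k.+1 then h k else 0).
Proof.
(* Two consecutive instances are compared because the unknown counts of [bold_F] then enter only
   through their difference, which [count_F] expresses by [bold_H]. *)
have := count_H_split m.+1; have := count_H_split m.
rewrite count_H2 count_H3 count_H33.
have := count_F_split m.
case: m => [|m]; rewrite ?count_0; first by lia.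
rewrite count_F2 count_F_head2 count_H2 count_H3 count_H33.
have := count_F_split m; have := count_F m.
case: m => [|m]; rewrite ?count_0; first by lia.
by rewrite count_F2 count_F_head2; lia.
Qed.

End Counting.

(** * Power series *)

Local Open Scope ring_scope.

Section PowerSeries.

Variable R : unitRingType.

Lemma fps_inv_1X n : fps_inv (fps_of_poly (1 - 'X : {poly R})) n = 1.
Proof.
suff E m : fps_inv_seq (fps_of_poly (1 - 'X : {poly R})) m = nseq m.+1 1.
  by rewrite /fps_inv E nth_nseq ltnSn.
have f0 : fps_of_poly (1 - 'X : {poly R}) 0%N = 1.
  by rewrite /fps_of_poly coefB coef1 coefX subr0.
elim: m => [|m IHm]; first by rewrite /= f0 invr1.
have rcons1 : rcons (nseq m.+1 1) 1 = nseq m.+2 1 :> seq R.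
  by rewrite -cats1 -[[:: 1]]/(nseq 1 1) -nseqD addn1.
have nth1 : (nseq m.+1 (1 : R))`_m = 1 by rewrite nth_nseq ltnSn.
rewrite -rcons1 [LHS]/= IHm f0 invr1 big_ord_recl big1 => [|i _].
  congr rcons; rewrite addr0 subn0 nth1 mulr1 /fps_of_poly coefB coef1 coefX
    sub0r.
  by rewrite mulrNN mulr1.
by rewrite /fps_of_poly coefB coef1 coefX subr0 mul0r.
Qed.

Lemma fps_div_1X (p : {poly R}) n :
  fps_div (fps_of_poly p) (fps_of_poly (1 - 'X)) n = \sum_(i < n.+1) p`_i.
Proof. by apply: eq_bigr => i _; rewrite fps_inv_1X mulr1. Qed.

(** Coefficientwise form of (1 - t) q g = p g: the coefficients of q are partial sums of those of
    p. *)
Lemma fps_mul_div_1X_S (p : {poly R}) (g : fps R) n :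
  let q := fps_div (fps_of_poly p) (fps_of_poly (1 - 'X)) in
  fps_mul q g n.+1 = fps_mul q g n + fps_mul (fps_of_poly p) g n.+1.
Proof.
move=> q; rewrite /fps_mul [LHS]big_ord_recl [X in _ =
  _ + X]big_ord_recl /= !subn0.
rewrite {1}/q fps_div_1X big_ord_recl big_ord0 addr0 addrCA -big_split /=.
congr (_ + _); apply: eq_bigr => i _; rewrite /bump /= add1n subSS -mulrDl.
by congr (_ * _); rewrite /q !fps_div_1X [LHS]big_ord_recr.
Qed.

End PowerSeries.

Theorem theorem8 :
  gen_fun bold_Hstar =1
    fps_mul
      (fps_div
         (fps_of_poly (1 - 5%:R *: 'X + 5%:R *: 'X^2 - 3%:R *: 'X^3))
         (fps_of_poly (1 - 'X)))
      (gen_fun bold_H).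
Proof.
elim=> [|n IHn].
  rewrite /fps_mul big_ord1 /gen_fun -[count_maps bold_Hstar _]/(iso_classes _
    _).
  rewrite -[count_maps bold_H _]/(iso_classes bold_H 'I_(2 * (3 * 0))).
  by rewrite count_Hstar_0 count_H_0 mulr0.
rewrite fps_mul_div_1X_S -IHn.
have p_coef i : fps_of_poly (1 - 5%:R *: 'X + 5%:R *: 'X^2 - 3%:R *: 'X^3) i
    = [:: 1; -5%:R; 5%:R; -3%:R]`_i :> rat.
  rewrite /fps_of_poly !(coefB, coefD, coefZ, coef1, coefX, coefXn).
  by case: i => [|[|[|[|i]]]] //=; rewrite ?nth_nil.
rewrite -[gen_fun bold_Hstar _]/((iso_classes bold_Hstar _)%:R).
rewrite -[gen_fun bold_Hstar n]/((iso_classes bold_Hstar _)%:R).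
pose g k : rat := (iso_classes bold_H 'I_(2 * (3 * k)))%:R.
rewrite /fps_mul big_ord_recl p_coef mul1r subn0 -[gen_fun bold_H n.+1]/(g
  n.+1).
have -> : \sum_(i < n.+1) fps_of_poly (1 - 5%:R *: 'X + 5%:R *: 'X^2 - 3%:R *:
  'X^3)
    (lift ord0 i) * gen_fun bold_H (n.+1 - lift ord0 i)%N
  = \sum_(i < n.+1) [:: -5%:R; 5%:R; -3%:R]`_i * g (n - i)%N.
  by apply: eq_bigr => i _; rewrite p_coef lift0 subSS.
have := congr1 (GRing.natmul (1 : rat)) (count_Hstar_S n).
rewrite !(natrM, natrD) -/(g _) -/(g _).
(* The recurrence reaches three coefficients back, so the two smallest indices have truncated
   sums. *)
case: n {IHn} => [|[|n]].
- by rewrite big_ord1 /= subn0; lra.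
- by rewrite !big_ord_recl big_ord0 /= subn0 subSS subn0 -/(g 0%N); lra.
rewrite !(big_ord_recl n.+2) (big_ord_recl n.+1) (big_ord_recl n).
(* Beyond the three listed coefficients the numerator, of degree 3, contributes nothing. *)
rewrite [X in _ + (_ + (_ + X))]big1 => [|i _];
  last by rewrite /= nth_nil mul0r.
by rewrite /= /bump /= !subSS !subn0 -!/(g _); lra.
Qed.
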